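(* Let $A$ be a $\Sigma^{\mathcal P}$ sentence of the language of set theory (i.e. $A$ does not contain the relation symbol $\mathsf R$). If $\mathrm{KP}(\mathcal P)+\mathrm{GAC}\vdash A$, then $\mathrm{KP}(\mathcal P)+\mathrm{AC}\vdash A$.
   Context: Subset bounded quantifiers $\exists x\subseteq y\,\ldots$ and $\forall x\subseteq y\,\ldots$ abbreviate $\exists x(x\subseteq y\wedge\ldots)$ and $\forall x(x\subseteq y\to\ldots)$. The $\Delta_0^{\mathcal P}$-formulae form the smallest class containing the atomic formulae and closed under $\wedge,\vee,\to,\neg$ and the quantifiers $\forall x\in a$, $\exists x\in a$, $\forall x\subseteq a$, $\exists x\subseteq a$. The $\Sigma^{\mathcal P}$-formulae form the smallest class containing the $\Delta_0^{\mathcal P}$-formulae and closed under $\wedge,\vee$ and the quantifiers $\forall x\in a$, $\exists x\in a$, $\forall x\subseteq a$ and unbounded $\exists x$. Power Kripke–Platek set theory $\mathrm{KP}(\mathcal P)$ is the theory in the language of ZF with axioms: Extensionality, Pairing, Union, Infinity, Powerset, $\Delta_0^{\mathcal P}$-Separation ($\exists x\forall u[u\in x\leftrightarrow u\in a\wedge\varphi(u)]$ for $\Delta_0^{\mathcal P}$ $\varphi$), $\Delta_0^{\mathcal P}$-Collection ($\forall x\in a\,\exists y\,G(x,y)\to\exists z\,\forall x\in a\,\exists y\in z\,G(x,y)$ for $\Delta_0^{\mathcal P}$ $G$), and Set Induction for all formulae. $\mathrm{AC}$ is the axiom of choice. $\mathrm{KP}(\mathcal P)+\mathrm{GAC}$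 is the extension of $\mathrm{KP}(\mathcal P)$ to the language with a new binary relation symbol $\mathsf R$, where all axiom schemes of $\mathrm{KP}(\mathcal P)$ are extended to formulae of the richer language (so $\Delta_0^{\mathcal P}$ formulae may contain $\mathsf R$), together with the axioms $\forall x\forall y\forall z[\mathsf R(x,y)\wedge\mathsf R(x,z)\to y=z]$ and $\forall x[x\neq\emptyset\to\exists y\in x\,\mathsf R(x,y)]$. *)

(* Defs.v *)
From Stdlib Require Import List PeanoNat.
Import ListNotations.

Set Implicit Arguments.

(** First-order formulae over [=], [∈] and a type [Q] of further binary
    relation symbols, with de Bruijn indices: a bound variable is counted by the
    number of quantifiers between it and its binder.  There are no function
    symbols, so variables are the only terms. *)

Inductive form (Q : Type) : Type :=
| Mem : nat -> nat -> form Q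
| Eq  : nat -> nat -> form Q
| Rel : Q -> nat -> nat -> form Q
| And : form Q -> form Q -> form Q
| Or  : form Q -> form Q -> form Q
| Imp : form Q -> form Q -> form Q
| Neg : form Q -> form Q
| All : form Q -> form Q
| Ex  : form Q -> form Q.

Arguments Mem {Q} _ _.
Arguments Eq {Q} _ _.

Declare Scope form_scope.
Delimit Scope form_scope with form.
Bind Scope form_scope with form.
Notation "i ∈ j" := (Mem i j) (at level 70) : form_scope.
Notation "i ≐ j" := (Eq i j) (at level 70) : form_scope.
Notation "A ∧ B" := (And A B) (at level 80, right associativity) : form_scope.
Notation "A ∨ B" := (Or A B) (at level 85, right associativity) : form_scope.
Notation "A → B" := (Imp A B)
  (at level 99, B at level 200, right associativity) : form_scope.
Notation "A ↔ B" := (And (Imp A B) (Imp B A)) (at level 95) : form_scope.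
Local Open Scope form_scope.

Definition up (f : nat -> nat) (n : nat) : nat :=
  match n with 0 => 0 | S m => S (f m) end.

Fixpoint ren {Q} (f : nat -> nat) (A : form Q) : form Q :=
  match A with
  | Mem i j => Mem (f i) (f j)
  | Eq i j => Eq (f i) (f j)
  | Rel r i j => Rel r (f i) (f j)
  | And A B => And (ren f A) (ren f B)
  | Or A B => Or (ren f A) (ren f B)
  | Imp A B => Imp (ren f A) (ren f B)
  | Neg A => Neg (ren f A)
  | All A => All (ren (up f) A)
  | Ex A => Ex (ren (up f) A)
  end.

Definition shift {Q} (A : form Q) : form Q := ren S A.

Definition inst {Q} (t : nat) (A : form Q) : form Q :=
  ren (fun n => match n with 0 => t | S m => m end) A.

(** The least [n] such that every free variable of [A] is below [n]. *)
Fixpoint fv_bound {Q} (A : form Q) : nat :=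
  match A with
  | Mem i j | Eq i j | Rel _ i j => Nat.max (S i) (S j)
  | And A B | Or A B | Imp A B => Nat.max (fv_bound A) (fv_bound B)
  | Neg A => fv_bound A
  | All A | Ex A => Nat.pred (fv_bound A)
  end.

Definition sentence {Q} (A : form Q) : Prop := fv_bound A = 0.

Definition closure {Q} (A : form Q) : form Q :=
  Nat.iter (fv_bound A) (@All Q) A.

Fixpoint map_rel {Q Q' : Type} (f : Q -> Q') (A : form Q) : form Q' :=
  match A with
  | Mem i j => Mem i j
  | Eq i j => Eq i j
  | Rel r i j => Rel (f r) i j
  | And A B => And (map_rel f A) (map_rel f B)
  | Or A B => Or (map_rel f A) (map_rel f B)
  | Imp A B => Imp (map_rel f A) (map_rel f B)
  | Neg A => Neg (map_rel f A)
  | All A => All (map_rel f A)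
  | Ex A => Ex (map_rel f A)
  end.

(** Classical natural deduction with equality.  The rules for [∀] and [∃] do
    not shift the axioms [T]: theories are meant to consist of sentences. *)

Definition theory (Q : Type) : Type := form Q -> Prop.

Inductive derivable {Q} (T : theory Q) : list (form Q) -> form Q -> Prop :=
| d_ax G A : T A -> derivable T G A
| d_hyp G A : In A G -> derivable T G A
| d_andI G A B : derivable T G A -> derivable T G B -> derivable T G (A ∧ B)
| d_andE1 G A B : derivable T G (A ∧ B) -> derivable T G A
| d_andE2 G A B : derivable T G (A ∧ B) -> derivable T G B
| d_orI1 G A B : derivable T G A -> derivable T G (A ∨ B)
| d_orI2 G A B : derivable T G B -> derivable T G (A ∨ B)
| d_orE G A B C :
    derivable T G (A ∨ B) -> derivable T (A :: G) C -> derivable T (B :: G) C ->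
    derivable T G C
| d_impI G A B : derivable T (A :: G) B -> derivable T G (A → B)
| d_impE G A B : derivable T G (A → B) -> derivable T G A -> derivable T G B
| d_negI G A B :
    derivable T (A :: G) B -> derivable T (A :: G) (Neg B) ->
    derivable T G (Neg A)
| d_negE G A B : derivable T G A -> derivable T G (Neg A) -> derivable T G B
| d_dne G A : derivable T G (Neg (Neg A)) -> derivable T G A
| d_allI G A : derivable T (map shift G) A -> derivable T G (All A)
| d_allE G A t : derivable T G (All A) -> derivable T G (inst t A)
| d_exI G A t : derivable T G (inst t A) -> derivable T G (Ex A)
| d_exE G A B :
    derivable T G (Ex A) -> derivable T (A :: map shift G) (shift B) ->
    derivable T G B
| d_eqI G i : derivable T G (i ≐ i)
| d_eqE G A i j :
    derivable T G (i ≐ j) -> derivable T G (inst i A) -> derivable T G (inst j A).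

Definition provable {Q} (T : theory Q) (A : form Q) : Prop := derivable T [] A.

(** In the bounded quantifiers the bound [a] is an index of the outer context,
    so it is never the quantified variable. *)

Definition subset {Q} (i j : nat) : form Q := All (0 ∈ S i → 0 ∈ S j).

Definition AllIn {Q} (a : nat) (A : form Q) : form Q := All (0 ∈ S a → A).
Definition ExIn {Q} (a : nat) (A : form Q) : form Q := Ex (0 ∈ S a ∧ A).
Definition AllSub {Q} (a : nat) (A : form Q) : form Q := All (subset 0 (S a) → A).
Definition ExSub {Q} (a : nat) (A : form Q) : form Q := Ex (subset 0 (S a) ∧ A).

Inductive Delta0P {Q} : form Q -> Prop :=
| D_mem i j : Delta0P (i ∈ j)
| D_eq i j : Delta0P (i ≐ j)
| D_rel r i j : Delta0P (Rel r i j)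
| D_and A B : Delta0P A -> Delta0P B -> Delta0P (A ∧ B)
| D_or A B : Delta0P A -> Delta0P B -> Delta0P (A ∨ B)
| D_imp A B : Delta0P A -> Delta0P B -> Delta0P (A → B)
| D_neg A : Delta0P A -> Delta0P (Neg A)
| D_allIn a A : Delta0P A -> Delta0P (AllIn a A)
| D_exIn a A : Delta0P A -> Delta0P (ExIn a A)
| D_allSub a A : Delta0P A -> Delta0P (AllSub a A)
| D_exSub a A : Delta0P A -> Delta0P (ExSub a A).

Inductive SigmaP {Q} : form Q -> Prop :=
| S_delta A : Delta0P A -> SigmaP A
| S_and A B : SigmaP A -> SigmaP B -> SigmaP (A ∧ B)
| S_or A B : SigmaP A -> SigmaP B -> SigmaP (A ∨ B)
| S_allIn a A : SigmaP A -> SigmaP (AllIn a A)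
| S_exIn a A : SigmaP A -> SigmaP (ExIn a A)
| S_allSub a A : SigmaP A -> SigmaP (AllSub a A)
| S_ex A : SigmaP A -> SigmaP (Ex A).

Definition is_empty {Q} (x : nat) : form Q := All (Neg (0 ∈ S x)).

(** [z = y ∪ {y}] *)
Definition is_succ {Q} (z y : nat) : form Q :=
  All (0 ∈ S z ↔ (0 ∈ S y ∨ 0 ≐ S y)).

(** [p = {a, b}] *)
Definition is_upair {Q} (p a b : nat) : form Q :=
  All (0 ∈ S p ↔ (0 ≐ S a ∨ 0 ≐ S b)).

(** [p = ⟨a, b⟩ = {{a}, {a, b}}]; inside, index 1 is [{a}] and index 0 is
    [{a, b}]. *)
Definition is_opair {Q} (p a b : nat) : form Q :=
  Ex (Ex (is_upair 1 (S (S a)) (S (S a)) ∧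
          is_upair 0 (S (S a)) (S (S b)) ∧
          is_upair (S (S p)) 1 0)).

(** [⟨a, b⟩ ∈ f] *)
Definition opair_in {Q} (a b f : nat) : form Q :=
  ExIn f (is_opair 0 (S a) (S b)).

Definition extensionality {Q} : form Q :=
  All (All (All (0 ∈ 2 ↔ 0 ∈ 1) → 1 ≐ 0)).

Definition pairing {Q} : form Q := All (All (Ex (is_upair 0 2 1))).

(** [∀a ∃z ∀u (u ∈ z ↔ ∃y∈a u ∈ y)] *)
Definition union {Q} : form Q := All (Ex (All (0 ∈ 1 ↔ ExIn 2 (1 ∈ 0)))).

(** [∃x (∅ ∈ x ∧ ∀y∈x y ∪ {y} ∈ x)] *)
Definition infinity {Q} : form Q :=
  Ex (ExIn 0 (is_empty 0) ∧ AllIn 0 (ExIn 1 (is_succ 0 1))).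

(** [∀a ∃z ∀u (u ∈ z ↔ u ⊆ a)] *)
Definition powerset {Q} : form Q := All (Ex (All (0 ∈ 1 ↔ subset 0 2))).

(** [∀a ∃x ∀u (u ∈ x ↔ u ∈ a ∧ A(u))]: in [A], index 0 is [u], index 1 is [a],
    and the others are parameters; the renaming makes [A] skip [x]. *)
Definition separation {Q} (A : form Q) : form Q :=
  All (Ex (All (0 ∈ 1 ↔ (0 ∈ 2 ∧ ren (up S) A)))).

(** [∀a (∀x∈a ∃y A(x,y) → ∃z ∀x∈a ∃y∈z A(x,y))]: in [A], index 0 is [y], index 1
    is [x], index 2 is [a], and the others are parameters; the renaming makes
    [A] skip [z]. *)
Definition collection {Q} (A : form Q) : form Q :=
  All (AllIn 0 (Ex A) → Ex (AllIn 1 (ExIn 1 (ren (up (up S)) A)))).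

(** [∀x (∀y∈x A(y) → A(x)) → ∀x A(x)]: in [A], index 0 is the induction
    variable, and the others are parameters. *)
Definition set_induction {Q} (A : form Q) : form Q :=
  All (AllIn 0 (ren (up S) A) → A) → All A.

Inductive KPP {Q} : theory Q :=
| KPP_ext : KPP extensionality
| KPP_pair : KPP pairing
| KPP_union : KPP union
| KPP_inf : KPP infinity
| KPP_pow : KPP powerset
| KPP_sep A : Delta0P A -> KPP (closure (separation A))
| KPP_coll A : Delta0P A -> KPP (closure (collection A))
| KPP_set_induction A : KPP (closure (set_induction A)).

(** Every set [x] of nonempty sets has a choice function: a set [f] of pairs
    with first components in [x] such that every [y ∈ x] has a unique value, and
    this value is in [y]. *)
Definition choice {Q} : form Q :=
  All (AllIn 0 (Neg (is_empty 0)) →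
       Ex (AllIn 0 (ExIn 2 (Ex (is_opair 2 1 0))) ∧
           AllIn 1 (ExIn 0 (opair_in 1 0 2 ∧ All (opair_in 2 0 3 → 0 ≐ 1))))).

(** The language of set theory has no further relation symbol. *)
Definition set_form : Type := form Empty_set.

Inductive KPP_AC : theory Empty_set :=
| AC_KPP A : KPP A -> KPP_AC A
| AC_choice : KPP_AC choice.

Inductive choice_symbol : Set := R.

Definition add_R (A : set_form) : form choice_symbol :=
  map_rel (fun r : Empty_set => match r with end) A.

Definition R_functional : form choice_symbol :=
  All (All (All ((Rel R 2 1 ∧ Rel R 2 0) → 1 ≐ 0))).

Definition R_choice : form choice_symbol :=
  All (Neg (is_empty 0) → ExIn 0 (Rel R 1 0)).

Inductive KPP_GAC : theory choice_symbol :=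
| GAC_KPP A : KPP A -> KPP_GAC A
| GAC_functional : KPP_GAC R_functional
| GAC_choice : KPP_GAC R_choice.

(* Main.v *)
(** By completeness it suffices to show that [A] holds in every model of
    KP(P) + AC.  Over such a model, force a global choice function.  Forcing with
    set-sized choice functions alone need not preserve Collection, since KP(P)
    does not prove that well-orderings are isomorphic to ordinals.  So a condition
    consists of a supertransitive set [d], a choice function [f] on [d], and a
    set of promises "no [y] satisfies [G(y, c)]", where [G] ranges over the
    finitely many Collection formulae of the given derivation; and it is required
    that [f] can be changed outside [d] to a choice function on any larger
    supertransitive set so that the promises still hold there.

    Collection in the ground model is a compactness principle for this
    requirement.  If no promise "no [y] satisfies [G(x, y)]" with [x] in [a] can be
    added to a condition, then for each [x] some height refutes it; one height
    serves all [x] in [a], and any extension of the condition to that height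
    bounds the witnesses.  The same argument shows that conditions extend to
    arbitrary heights.  Bounded quantification over members and subsets does not
    leave a supertransitive set, so a bounded formula with parameters in [d] is
    forced exactly if [f] satisfies it, which gives Separation; Set Induction
    holds since forcing is definable.  The universe of sets does not change, so
    sentences without [R] are forced exactly if they are true. *)

Require Import Defs.
From Stdlib Require Import List PeanoNat Wf_nat Lia Cantor.
From Stdlib Require Import Classical ClassicalEpsilon FunctionalExtensionality.
Import ListNotations.
Set Implicit Arguments.

(** * Renaming and derivations *)

Definition scons {X} (x : X) (rho : nat -> X) (n : nat) : X :=
  match n with 0 => x | S m => rho m end.

Lemma scons_eta X (rho : nat -> X) : scons (rho 0) (fun n => rho (S n)) = rho.
Proof. apply functional_extensionality; intros [|n]; reflexivity. Qed.

Lemma scons_up X (x : X) rho f :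
  (fun n => scons x rho (up f n)) = scons x (fun n => rho (f n)).
Proof. apply functional_extensionality; intros [|n]; reflexivity. Qed.

Lemma ren_agree Q (A : form Q) : forall f g,
  (forall i, i < fv_bound A -> f i = g i) -> ren f A = ren g A.
Proof.
  induction A; cbn; intros f g H; f_equal; try (apply H; lia);
    try (match goal with IH : forall f g, _ -> ren f ?B = _ |- ren _ ?B = _ => apply IH end;
         intros [|m] Hm; cbn; try reflexivity; try (f_equal; apply H; lia); apply H; lia).
Qed.

Lemma ren_ren Q (A : form Q) : forall f g,
  ren f (ren g A) = ren (fun n => f (g n)) A.
Proof.
  assert (E : forall f g, (fun n => up f (up g n)) = up (fun n => f (g n)))
    by (intros; apply functional_extensionality; intros [|n]; reflexivity).
  induction A; cbn; intros f g; f_equal; auto; rewrite <- (E f g); auto.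
Qed.

Lemma ren_id Q (A : form Q) : ren (fun n => n) A = A.
Proof.
  assert (E : up (fun n => n) = fun n => n)
    by (apply functional_extensionality; intros [|n]; reflexivity).
  induction A; cbn; f_equal; auto; rewrite E; auto.
Qed.

Lemma ren_sentence Q (A : form Q) f : sentence A -> ren f A = A.
Proof.
  intros HA. rewrite <- ren_id. apply ren_agree.
  intros i Hi. red in HA. lia.
Qed.

Lemma inst_ren Q (A : form Q) f t : inst (f t) (ren (up f) A) = ren f (inst t A).
Proof.
  unfold inst. rewrite !ren_ren. f_equal.
  apply functional_extensionality; intros [|n]; reflexivity.
Qed.

Lemma inst_ren_up Q (A : form Q) f t : inst t (ren (up f) A) = ren (scons t f) A.
Proof.
  unfold inst. rewrite ren_ren. f_equal.
  apply functional_extensionality; intros [|n]; reflexivity.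
Qed.

Lemma ren_shift Q (A : form Q) f : ren (up f) (shift A) = shift (ren f A).
Proof. unfold shift. now rewrite !ren_ren. Qed.

Lemma map_ren_shift Q (G : list (form Q)) f :
  map (ren (up f)) (map shift G) = map shift (map (ren f) G).
Proof. rewrite !map_map. apply map_ext. intros A. apply ren_shift. Qed.

Lemma sentence_closure Q (A : form Q) : sentence (closure A).
Proof.
  unfold sentence, closure.
  assert (E : forall n, fv_bound (Nat.iter n (@All Q) A) = fv_bound A - n).
  { induction n; [cbn; lia|].
    change (Nat.pred (fv_bound (Nat.iter n (@All Q) A)) = fv_bound A - S n). lia. }
  rewrite E. lia.
Qed.

Section Derivations.
Variables (Q : Type) (T : theory Q).

Lemma derivable_weaken G A : derivable T G A -> forall G', incl G G' -> derivable T G' A.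
Proof.
  assert (Hc : forall (B : form Q) G G', incl G G' -> incl (B :: G) (B :: G'))
    by (intros B G1 G2 H; apply incl_cons; [now left | now apply incl_tl]).
  induction 1; intros G' HG;
    try solve [econstructor; eauto].
  - apply d_allI. apply IHderivable. now apply incl_map.
  - eapply d_exE; [now apply IHderivable1|]. apply IHderivable2. apply Hc. now apply incl_map.
Qed.

Lemma derivable_mono (T1 T' : theory Q) G A :
  derivable T1 G A -> (forall X, T1 X -> T' X) -> derivable T' G A.
Proof. intros D HT. induction D; try solve [econstructor; eauto].
  - exact (d_negI IHD1 IHD2).
  - exact (d_negE B IHD1 IHD2).
Qed.

(** Renamings fix the axioms because these are sentences, and they commute with the shifts and
    instances in the quantifier rules. *)
Lemma derivable_ren (HT : forall X, T X -> sentence X) G A :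
  derivable T G A -> forall f, derivable T (map (ren f) G) (ren f A).
Proof.
  induction 1; intros f; cbn in *;
    try solve [econstructor; eauto].
  - rewrite ren_sentence by now apply HT. now apply d_ax.
  - apply d_hyp. now apply in_map.
  - apply d_allI. rewrite <- map_ren_shift. apply IHderivable.
  - rewrite <- inst_ren. apply d_allE. apply IHderivable.
  - apply d_exI with (t := f t). rewrite inst_ren. apply IHderivable.
  - eapply d_exE; [apply IHderivable1|]. rewrite <- map_ren_shift, <- ren_shift. apply IHderivable2.
  - rewrite <- inst_ren. eapply d_eqE; [apply IHderivable1|]. rewrite inst_ren. apply IHderivable2.
Qed.

(** A derivation is finite. This bounds the Collection formulae that the promises of a forcing
    condition have to cover. *)
Lemma derivable_compact G A :
  derivable T G A ->
  exists L, (forall X, In X L -> T X) /\ derivable (fun X => In X L) G A.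
Proof.
  assert (W1 : forall L L' G A, derivable (fun X => In X L) G A ->
                derivable (fun X => In X (L ++ L')) G A)
    by (intros L L' G0 A0 D; apply derivable_mono with (1 := D); intros; apply in_or_app; auto).
  assert (W2 : forall L L' G A, derivable (fun X => In X L) G A ->
                derivable (fun X => In X (L' ++ L)) G A)
    by (intros L L' G0 A0 D; apply derivable_mono with (1 := D); intros; apply in_or_app; auto).
  assert (TA : forall L L', (forall X, In X L -> T X) -> (forall X, In X L' -> T X) ->
                forall X, In X (L ++ L') -> T X)
    by (intros L L' H1 H2 X HX; apply in_app_or in HX; destruct HX; auto).
  induction 1;
    try match goal with
        | H : T A |- _ => exists [A]; split; [intros X [<-|[]]; exact H | apply d_ax; now left]
        end;
    repeat match goal with
           | H : exists L, _ /\ _ |- _ => let L := fresh "L" in destruct H as (L & ? & ?)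
           end.
  all: match goal with
    | D : derivable (fun X => In X ?L) _ _, D' : derivable (fun X => In X ?L') _ _,
      D'' : derivable (fun X => In X ?L'') _ _ |- _ =>
        exists (L ++ L' ++ L''); split; [apply TA; [assumption | apply TA; assumption]|];
        apply (W1 _ (L' ++ L'')) in D;
        apply (W1 _ L''), (W2 _ L) in D'; apply (W2 _ L'), (W2 _ L) in D'';
        first [ eapply d_orE; eassumption ]
    | D : derivable (fun X => In X ?L) _ _, D' : derivable (fun X => In X ?L') _ _ |- _ =>
        exists (L ++ L'); split; [apply TA; assumption|];
        apply (W1 _ L') in D; apply (W2 _ L) in D';
        first [ exact (d_andI D D') | exact (d_andI D' D) | exact (d_impE D D')
              | exact (d_impE D' D) | exact (d_negI D D') | exact (d_negI D' D)
              | exact (d_negE _ D D') | exact (d_negE _ D' D)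
              | exact (d_exE _ D D') | exact (d_exE _ D' D)
              | exact (d_eqE _ D D') | exact (d_eqE _ D' D) ]
    | _ : derivable (fun X => In X ?L) _ _ |- _ =>
        exists L; split; [assumption | solve [econstructor; eauto] ]
    | _ => exists []; split; [intros X [] | first [apply d_hyp; assumption | apply d_eqI] ]
    end.
Qed.
End Derivations.

(** * Completeness *)

Fixpoint sat {M Q : Type} (mem : M -> M -> Prop) (I : Q -> M -> M -> Prop)
    (rho : nat -> M) (A : form Q) : Prop :=
  match A with
  | Mem i j => mem (rho i) (rho j)
  | Eq i j => rho i = rho j
  | Rel r i j => I r (rho i) (rho j)
  | And A B => sat mem I rho A /\ sat mem I rho B
  | Or A B => sat mem I rho A \/ sat mem I rho B
  | Imp A B => sat mem I rho A -> sat mem I rho B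
  | Neg A => ~ sat mem I rho A
  | All A => forall x, sat mem I (scons x rho) A
  | Ex A => exists x, sat mem I (scons x rho) A
  end.

Section Satisfaction.
Variables (M Q : Type) (mem : M -> M -> Prop) (I : Q -> M -> M -> Prop).

Lemma sat_ren (A : form Q) : forall f rho,
  sat mem I rho (ren f A) <-> sat mem I (fun n => rho (f n)) A.
Proof.
  induction A; cbn; intros f rho; try tauto;
    try (rewrite IHA1, IHA2; tauto); try (rewrite IHA; tauto).
  - split; intros H x; specialize (H x);
      [apply IHA in H; rewrite scons_up in H | apply IHA; rewrite scons_up]; exact H.
  - split; intros [x H]; exists x;
      [apply IHA in H; rewrite scons_up in H | apply IHA; rewrite scons_up]; exact H.
Qed.

Lemma sat_agree (A : form Q) : forall rho sigma,
  (forall i, i < fv_bound A -> rho i = sigma i) ->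
  (sat mem I rho A <-> sat mem I sigma A).
Proof.
  induction A; cbn; intros rho sigma H;
    try (rewrite !H by lia; tauto);
    try (rewrite (IHA1 rho sigma), (IHA2 rho sigma) by (intros; apply H; lia); tauto).
  - rewrite (IHA rho sigma) by auto. tauto.
  - assert (E : forall x, sat mem I (scons x rho) A <-> sat mem I (scons x sigma) A)
      by (intros x; apply IHA; intros [|i] Hi; cbn; [reflexivity | apply H; lia]).
    split; intros F x; apply E, F.
  - assert (E : forall x, sat mem I (scons x rho) A <-> sat mem I (scons x sigma) A)
      by (intros x; apply IHA; intros [|i] Hi; cbn; [reflexivity | apply H; lia]).
    split; intros [x F]; exists x; apply E, F.
Qed.

Lemma sat_closure (A : form Q) rho :
  (forall sigma, sat mem I sigma (closure A)) -> sat mem I rho A.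
Proof.
  unfold closure. revert rho. generalize (fv_bound A) as n.
  induction n; intros rho H; [apply H|].
  apply IHn. intros sigma. rewrite <- (scons_eta sigma).
  exact (H (fun n => sigma (S n)) (sigma 0)).
Qed.
End Satisfaction.

Section Completeness.
Variables (Q : Type) (T : theory Q) (enum : nat -> form Q).
Hypothesis T_sentences : forall X, T X -> sentence X.
Hypothesis enum_surj : forall A, exists n, enum n = A.

Definition consistent (G : list (form Q)) : Prop := ~ forall C, derivable T G C.

Lemma consistent_cons_or_neg G A :
  consistent G -> consistent (A :: G) \/ consistent (Neg A :: G).
Proof.
  intros HG. apply NNPP. intros H. apply not_or_and in H as [H1 H2].
  apply NNPP in H1, H2. apply HG. intros C.
  apply d_negE with (A := A).
  - apply d_dne. now apply d_negI with (B := C).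
  - now apply d_negI with (B := C).
Qed.

(** A variable above all free variables of [G] serves as a Henkin constant. *)
Lemma consistent_witness G B :
  consistent G -> In (Ex B) G -> exists t, consistent (inst t B :: G).
Proof.
  intros HG HB.
  set (t := list_max (map (@fv_bound Q) G)).
  assert (Hfresh : forall X, In X G -> fv_bound X <= t).
  { intros X HX. assert (F := proj1 (list_max_le (map (@fv_bound Q) G) t) (le_n _)).
    rewrite Forall_forall in F. apply F. now apply in_map. }
  exists t. intros H. apply HG. intros C.
  (* Sending [t] to 0 and shifting the rest turns a derivation from [inst t B :: G] into one from
     [B :: map shift G], the shape that ∃-elimination requires. *)
  pose (f := fun n => if Nat.eq_dec n t then 0 else S n).
  assert (Hf : forall n, n < t -> f n = S n)
    by (intros n Hn; unfold f; destruct (Nat.eq_dec n t); [lia | reflexivity]).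
  assert (EG : map (ren f) G = map shift G).
  { apply map_ext_in. intros X HX. apply ren_agree. intros i Hi. apply Hf.
    specialize (Hfresh X HX). lia. }
  assert (EB : ren f (inst t B) = B).
  { unfold inst. rewrite ren_ren. rewrite <- (ren_id B) at 2. apply ren_agree.
    intros [|i] Hi; unfold f at 1.
    - destruct (Nat.eq_dec t t); [reflexivity | lia].
    - specialize (Hfresh _ HB). cbn in Hfresh. destruct (Nat.eq_dec i t); [lia | reflexivity]. }
  assert (D : forall C, derivable T (B :: map shift G) C).
  (* A closed contradiction survives the renaming unchanged. *)
  { intros C'. set (bot := And (All (Eq 0 0)) (Neg (All (Eq 0 0))) : form Q).
    assert (D := derivable_ren T_sentences (H bot) f). cbn [map] in D.
    rewrite EG, EB, ren_sentence in D by reflexivity.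
    eapply d_negE; [exact (d_andE1 D) | exact (d_andE2 D)]. }
  apply d_exE with (A := B); [now apply d_hyp | apply D].
Qed.

(** A witness is added together with an existential formula, while only finitely many variables are
    in use. If [Neg A] is added instead, no witness is owed. *)
Lemma consistent_step G A :
  consistent G ->
  exists G', consistent G' /\ incl G G' /\ (In A G' \/ In (Neg A) G') /\
    (forall B, A = Ex B -> In A G' -> ~ In (Neg A) G' -> exists t, In (inst t B) G').
Proof.
  intros HG. destruct (classic (consistent (A :: G))) as [HA|HA].
  - destruct (classic (exists B, A = Ex B)) as [[B ->]|HB].
    + destruct (consistent_witness B HA) as [t Ht]; [now left|].
      exists (inst t B :: Ex B :: G). repeat split; auto.
      * do 2 apply incl_tl. apply incl_refl.
      * left. right. now left.
      * intros B' E _ _. injection E as <-. exists t. now left.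
    + exists (A :: G). repeat split; auto.
      * apply incl_tl, incl_refl.
      * left. now left.
      * intros B E. exfalso; eauto.
  - exists (Neg A :: G). repeat split.
    + destruct (consistent_cons_or_neg A HG); tauto.
    + apply incl_tl, incl_refl.
    + right. now left.
    + intros B _ _ H. exfalso. apply H. now left.
Qed.

Variables (A0 : form Q).
Hypothesis A0_underivable : ~ derivable T [] A0.

Lemma consistent_start : consistent [Neg A0].
Proof.
  intros H. apply A0_underivable. apply d_dne.
  apply d_negI with (B := A0); apply H.
Qed.

Definition extend (n : nat) (G : {G | consistent G}) : {G | consistent G} :=
  let s := constructive_indefinite_description _ (consistent_step (enum n) (proj2_sig G)) in
  exist _ (proj1_sig s) (proj1 (proj2_sig s)).

Fixpoint chain (n : nat) : {G | consistent G} :=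
  match n with
  | 0 => exist _ [Neg A0] consistent_start
  | S n => extend n (chain n)
  end.

Lemma chain_incl n m : n <= m -> incl (proj1_sig (chain n)) (proj1_sig (chain m)).
Proof.
  induction 1; [apply incl_refl|]. eapply incl_tran; [exact IHle|].
  cbn. unfold extend. cbn. now destruct (proj2_sig (constructive_indefinite_description _
    (consistent_step (enum m) (proj2_sig (chain m))))) as (? & ? & ?).
Qed.

(** The deductive closure of the union of the chain; it is complete, and every existential formula
    in it has a witness. *)
Definition henkin (A : form Q) : Prop := exists n, derivable T (proj1_sig (chain n)) A.

Lemma henkin_at n A : henkin A -> exists m, n <= m /\ derivable T (proj1_sig (chain m)) A.
Proof.
  intros [k Hk]. exists (Nat.max n k). split; [lia|].
  eapply derivable_weaken; [exact Hk|]. apply chain_incl. lia.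
Qed.

Lemma henkin_rule1 A B :
  (forall G, derivable T G A -> derivable T G B) -> henkin A -> henkin B.
Proof. intros H [n Hn]. exists n. auto. Qed.

Lemma henkin_rule2 A B C :
  (forall G, derivable T G A -> derivable T G B -> derivable T G C) ->
  henkin A -> henkin B -> henkin C.
Proof.
  intros H [n Hn] HB. destruct (henkin_at n HB) as (m & Hm & HBm). exists m.
  apply H; [|exact HBm]. eapply derivable_weaken; [exact Hn | now apply chain_incl].
Qed.

Lemma henkin_or_neg A : henkin A \/ henkin (Neg A).
Proof.
  destruct (enum_surj A) as [n <-].
  assert (H : In (enum n) (proj1_sig (chain (S n))) \/ In (Neg (enum n)) (proj1_sig (chain (S n)))).
  { cbn. unfold extend. cbn. now destruct (proj2_sig (constructive_indefinite_description _
      (consistent_step (enum n) (proj2_sig (chain n))))) as (? & ? & ? & ?). }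
  destruct H; [left|right]; exists (S n); now apply d_hyp.
Qed.

Lemma henkin_not_both A : henkin A -> ~ henkin (Neg A).
Proof.
  intros [n Hn] H. destruct (henkin_at n H) as (m & Hm & Hm').
  apply (proj2_sig (chain m)). intros C. eapply d_negE; [|exact Hm'].
  eapply derivable_weaken; [exact Hn | now apply chain_incl].
Qed.

Lemma henkin_neg A : henkin (Neg A) <-> ~ henkin A.
Proof.
  split.
  - intros H1 H2. exact (henkin_not_both H2 H1).
  - destruct (henkin_or_neg A); tauto.
Qed.

Lemma henkin_ex B : henkin (Ex B) <-> exists t, henkin (inst t B).
Proof.
  split.
  - intros H. destruct (enum_surj (Ex B)) as [n En].
    assert (Hn : (In (Ex B) (proj1_sig (chain (S n))) \/ In (Neg (Ex B)) (proj1_sig (chain (S n)))) /\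
      (forall B', Ex B = Ex B' -> In (Ex B) (proj1_sig (chain (S n))) ->
        ~ In (Neg (Ex B)) (proj1_sig (chain (S n))) ->
        exists t, In (inst t B') (proj1_sig (chain (S n))))).
    { rewrite <- En. cbn. unfold extend. cbn.
      now destruct (proj2_sig (constructive_indefinite_description _
      (consistent_step (enum n) (proj2_sig (chain n))))) as (? & ? & ? & ?). }
    assert (HN : ~ In (Neg (Ex B)) (proj1_sig (chain (S n)))).
    { intros HN. apply (henkin_not_both H). exists (S n). now apply d_hyp. }
    destruct Hn as [[Hn|Hn] Hw]; [|contradiction].
    destruct (Hw B eq_refl Hn HN) as [t Ht]. exists t. exists (S n). now apply d_hyp.
  - intros [t Ht]. revert Ht. apply henkin_rule1. intros G. apply d_exI.
Qed.

(** If [All B] fails, completeness and classical logic yield [Ex (Neg B)], whose witness refutes an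
    instance. *)
Lemma henkin_all B : henkin (All B) <-> forall t, henkin (inst t B).
Proof.
  split.
  - intros H t. revert H. apply henkin_rule1. intros G H. now apply d_allE.
  - intros H. apply NNPP. intros HN. apply henkin_neg in HN.
    assert (HE : henkin (Ex (Neg B))).
    { revert HN. apply henkin_rule1. intros G D. apply d_dne.
      apply d_negI with (B := All B); [|eapply derivable_weaken; [exact D | now apply incl_tl, incl_refl]].
      apply d_allI. apply d_dne.
      apply d_negI with (B := shift (Ex (Neg B))).
      - apply d_exI with (t := 0). cbn.
        assert (E : inst 0 (ren (up S) B) = B).
        { rewrite inst_ren_up. rewrite <- (ren_id B) at 2. apply ren_agree.
          intros [|i]; reflexivity. }
        unfold inst in *. cbn. rewrite E. apply d_hyp. now left.
      - apply d_hyp. right. cbn. now left. }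
    apply henkin_ex in HE as [t Ht]. cbn in Ht. apply (henkin_not_both (H t)). exact Ht.
Qed.

Lemma henkin_and A B : henkin (And A B) <-> henkin A /\ henkin B.
Proof.
  split.
  - intros H. split; revert H; apply henkin_rule1; intros G; [apply d_andE1 | apply d_andE2].
  - intros [H1 H2]. revert H1 H2. apply henkin_rule2. intros G. apply d_andI.
Qed.

Lemma henkin_or A B : henkin (Or A B) <-> henkin A \/ henkin B.
Proof.
  split.
  - intros H. apply NNPP. intros HN. apply not_or_and in HN as [H1 H2].
    apply henkin_neg in H1, H2.
    assert (H3 : henkin (And (Neg A) (Neg B))) by now apply henkin_and.
    revert H. apply henkin_neg. revert H3. apply henkin_rule1. intros G D.
    apply d_negI with (B := A).
    + eapply d_orE; [apply d_hyp; now left | apply d_hyp; now left|].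
      apply d_negE with (A := B); [apply d_hyp; now left|].
      eapply derivable_weaken; [exact (d_andE2 D)|]. now do 2 apply incl_tl.
    + eapply derivable_weaken; [exact (d_andE1 D)|]. now apply incl_tl.
  - intros [H|H]; revert H; apply henkin_rule1; intros G; [apply d_orI1 | apply d_orI2].
Qed.

Lemma henkin_imp A B : henkin (Imp A B) <-> (henkin A -> henkin B).
Proof.
  split.
  - apply henkin_rule2. intros G. apply d_impE.
  - intros H. destruct (henkin_or_neg A) as [HA|HA].
    + generalize (H HA). apply henkin_rule1. intros G D. apply d_impI.
      eapply derivable_weaken; [exact D|]. now apply incl_tl.
    + revert HA. apply henkin_rule1. intros G D. apply d_impI.
      apply d_negE with (A := A); [apply d_hyp; now left|].
      eapply derivable_weaken; [exact D|]. now apply incl_tl.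
Qed.

Lemma henkin_subst A i j : henkin (Eq i j) -> henkin (inst i A) -> henkin (inst j A).
Proof. apply henkin_rule2. intros G. apply d_eqE. Qed.

Lemma henkin_eq_refl i : henkin (Eq i i).
Proof. exists 0. apply d_eqI. Qed.

Lemma henkin_eq_sym i j : henkin (Eq i j) -> henkin (Eq j i).
Proof. intros H. exact (henkin_subst (Eq 0 (S i)) H (henkin_eq_refl i)). Qed.

Lemma henkin_eq_trans i j k : henkin (Eq i j) -> henkin (Eq j k) -> henkin (Eq i k).
Proof. intros H1 H2. exact (henkin_subst (Eq (S i) 0) H2 H1). Qed.

(** [sat] reads ≐ as true equality, so provably equal variables have to be identified. The least
    variable of a class represents it, which avoids a quotient type. *)
Lemma representative i : exists j, henkin (Eq i j) /\ forall k, henkin (Eq i k) -> j <= k.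
Proof.
  destruct (dec_inh_nat_subset_has_unique_least_element (fun j => henkin (Eq i j))) as [j [[H1 H2] _]].
  - intros n. apply classic.
  - exists i. apply henkin_eq_refl.
  - eauto.
Qed.

Definition rep (i : nat) : nat := proj1_sig (constructive_indefinite_description _ (representative i)).

Lemma rep_eq i : henkin (Eq i (rep i)).
Proof. unfold rep. now destruct constructive_indefinite_description as [? []]. Qed.

Lemma rep_least i k : henkin (Eq i k) -> rep i <= k.
Proof. unfold rep. destruct constructive_indefinite_description as [? []]. cbn. auto. Qed.

Lemma rep_compat i j : henkin (Eq i j) <-> rep i = rep j.
Proof.
  split; intros H.
  - apply Nat.le_antisymm; apply rep_least.
    + exact (henkin_eq_trans H (rep_eq j)).
    + exact (henkin_eq_trans (henkin_eq_sym H) (rep_eq i)).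
  - eapply henkin_eq_trans; [apply rep_eq|]. rewrite H. apply henkin_eq_sym, rep_eq.
Qed.

Definition term_model : Type := {i | rep i = i}.

Definition class_of (i : nat) : term_model :=
  exist _ (rep i) (eq_sym (proj1 (rep_compat i (rep i)) (rep_eq i))).

Lemma class_of_eq i j : class_of i = class_of j <-> henkin (Eq i j).
Proof.
  rewrite rep_compat. split; intros H.
  - exact (f_equal (@proj1_sig _ _) H).
  - apply eq_sig_hprop; [intros; apply Peano_dec.UIP_nat | exact H].
Qed.

Lemma class_of_surj (x : term_model) : exists i, x = class_of i.
Proof.
  destruct x as [i Hi]. exists i. apply eq_sig_hprop; [intros; apply Peano_dec.UIP_nat | now symmetry].
Qed.

Lemma henkin_binary (C : nat -> nat -> form Q) i j :
  (forall f i j, ren f (C i j) = C (f i) (f j)) ->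
  henkin (C (rep i) (rep j)) <-> henkin (C i j).
Proof.
  intros HC.
  assert (F : forall i j i' j', henkin (Eq i i') -> henkin (Eq j j') ->
                henkin (C i j) -> henkin (C i' j')).
  { intros i1 j1 i2 j2 Hi Hj H.
    assert (H1 := henkin_subst (C 0 (S j1)) Hi). unfold inst in H1. rewrite !HC in H1.
    assert (H2 := henkin_subst (C (S i2) 0) Hj). unfold inst in H2. rewrite !HC in H2. auto. }
  split; apply F; try apply rep_eq; apply henkin_eq_sym, rep_eq.
Qed.

Definition term_mem (x y : term_model) : Prop := henkin (Mem (proj1_sig x) (proj1_sig y)).
Definition term_rel (r : Q) (x y : term_model) : Prop := henkin (Rel r (proj1_sig x) (proj1_sig y)).

(** The truth lemma. Assignments are kept in the form [class_of] after a renaming [g], so that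
    extending one by an element corresponds to an instance of the renamed formula. *)
Lemma term_model_sat (A : form Q) : forall g,
  sat term_mem term_rel (fun n => class_of (g n)) A <-> henkin (ren g A).
Proof.
  assert (E : forall t g, scons (class_of t) (fun n => class_of (g n)) =
                          fun n => class_of (scons t g n))
    by (intros; apply functional_extensionality; intros [|n]; reflexivity).
  induction A; intros g; cbn [sat ren].
  - now apply (henkin_binary (@Mem Q)).
  - apply class_of_eq.
  - now apply (henkin_binary (Rel q)).
  - now rewrite IHA1, IHA2, henkin_and.
  - now rewrite IHA1, IHA2, henkin_or.
  - now rewrite IHA1, IHA2, henkin_imp.
  - now rewrite IHA, henkin_neg.
  - rewrite henkin_all. split; intros H.
    + intros t. rewrite inst_ren_up, <- IHA, <- E. apply H.
    + intros x. destruct (class_of_surj x) as [t ->].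
      rewrite E, IHA, <- inst_ren_up. apply H.
  - rewrite henkin_ex. split; intros [x H].
    + destruct (class_of_surj x) as [t ->]. exists t.
      now rewrite inst_ren_up, <- IHA, <- E.
    + exists (class_of x). now rewrite E, IHA, <- inst_ren_up.
Qed.

Theorem countermodel : exists (M : Type) (mem : M -> M -> Prop) (I : Q -> M -> M -> Prop) rho,
  (forall X, T X -> forall sigma, sat mem I sigma X) /\ ~ sat mem I rho A0.
Proof.
  exists term_model, term_mem, term_rel, class_of. split.
  - intros X HX sigma. apply sat_agree with (rho := fun n => class_of ((fun n => n) n)).
    + intros i Hi. rewrite (T_sentences HX : fv_bound X = 0) in Hi. lia.
    + apply term_model_sat. rewrite ren_id. exists 0. now apply d_ax.
  - intros H. apply (term_model_sat A0 (fun n => n)) in H. rewrite ren_id in H.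
    apply (henkin_not_both H). exists 0. apply d_hyp. now left.
Qed.
End Completeness.

(** * Enumeration of the formulae of set theory *)

Fixpoint decode (k n : nat) : set_form :=
  match k with
  | 0 => Mem 0 0
  | S k =>
      let (c, m) := Cantor.of_nat n in
      let (i, j) := Cantor.of_nat m in
      match c with
      | 0 => Mem i j
      | 1 => Eq i j
      | 2 => And (decode k i) (decode k j)
      | 3 => Or (decode k i) (decode k j)
      | 4 => Imp (decode k i) (decode k j)
      | 5 => Neg (decode k i)
      | 6 => All (decode k i)
      | _ => Ex (decode k i)
      end
  end.

Definition enum_form (n : nat) : set_form := let (k, m) := Cantor.of_nat n in decode k m.

(** The argument [k] bounds the depth of the decoded formula. Surjectivity is stated for all large
    [k] so that two subformulae can be decoded at a common depth. *)
Lemma decode_surj (A : set_form) : exists k0, forall k, k0 <= k -> exists n, decode k n = A.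
Proof.
  assert (S1 : forall c i j k, exists n, decode (S k) n = match c with
      | 0 => Mem i j
      | 1 => Eq i j
      | 2 => And (decode k i) (decode k j)
      | 3 => Or (decode k i) (decode k j)
      | 4 => Imp (decode k i) (decode k j)
      | 5 => Neg (decode k i)
      | 6 => All (decode k i)
      | _ => Ex (decode k i)
      end).
  { intros c i j k. exists (Cantor.to_nat (c, Cantor.to_nat (i, j))).
    cbn [decode]. now rewrite !Cantor.cancel_of_to. }
  assert (S2 : forall A B C : set_form,
    (exists k0, forall k, k0 <= k -> exists n, decode k n = A) ->
    (exists k0, forall k, k0 <= k -> exists n, decode k n = B) ->
    (forall k i j, decode k i = A -> decode k j = B -> exists n, decode (S k) n = C) ->
    exists k0, forall k, k0 <= k -> exists n, decode k n = C).
  { intros A' B C [k1 H1] [k2 H2] H. exists (S (Nat.max k1 k2)).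
    intros [|k] Hk; [lia|]. destruct (H1 k) as [i Hi]; [lia|]. destruct (H2 k) as [j Hj]; [lia|].
    eauto. }
  induction A as [i j|i j|[]|A IHA B IHB|A IHA B IHB|A IHA B IHB|A IHA|A IHA|A IHA].
  - exists 1. intros [|k] Hk; [lia|]. apply (S1 0 i j).
  - exists 1. intros [|k] Hk; [lia|]. apply (S1 1 i j).
  - apply S2 with (A := A) (B := B); auto. intros k i j <- <-. apply (S1 2).
  - apply S2 with (A := A) (B := B); auto. intros k i j <- <-. apply (S1 3).
  - apply S2 with (A := A) (B := B); auto. intros k i j <- <-. apply (S1 4).
  - apply S2 with (A := A) (B := A); auto. intros k i j <- _. apply (S1 5 i i).
  - apply S2 with (A := A) (B := A); auto. intros k i j <- _. apply (S1 6 i i).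
  - apply S2 with (A := A) (B := A); auto. intros k i j <- _. apply (S1 7 i i).
Qed.

Lemma enum_form_surj (A : set_form) : exists n, enum_form n = A.
Proof.
  destruct (decode_surj A) as [k H]. destruct (H k (le_n k)) as [n Hn].
  exists (Cantor.to_nat (k, n)). unfold enum_form. now rewrite Cantor.cancel_of_to.
Qed.

Lemma KPP_sentence Q (X : form Q) : KPP X -> sentence X.
Proof. destruct 1; try reflexivity; apply sentence_closure. Qed.

Lemma KPP_AC_sentence X : KPP_AC X -> sentence X.
Proof. destruct 1; [now apply KPP_sentence | reflexivity]. Qed.

Ltac splits := repeat match goal with |- _ /\ _ => split end.

(** * Set theory inside a model *)

Section SetModel.
Variables (M : Type) (mem : M -> M -> Prop) (I : Empty_set -> M -> M -> Prop).
Hypothesis model : forall X, KPP_AC X -> forall rho, sat mem I rho X.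
Local Notation "x ∈ y" := (mem x y).

(** Predicates on assignments stand in for formulae: a property of [rho] is shown definable by
    following its connectives, with de Bruijn indices naming its parameters. *)
Definition definable (K : set_form -> Prop) (P : (nat -> M) -> Prop) : Prop :=
  exists A, K A /\ forall rho, P rho <-> sat mem I rho A.

Definition D0 : ((nat -> M) -> Prop) -> Prop := definable Delta0P.
Definition Def : ((nat -> M) -> Prop) -> Prop := definable (fun _ => True).

Definition Sub (x y : M) : Prop := forall u, u ∈ x -> u ∈ y.

Lemma definable_iff K P P' : (forall rho, P' rho <-> P rho) -> definable K P -> definable K P'.
Proof. intros H [A [HA E]]. exists A. split; [exact HA|]. intros rho. now rewrite H. Qed.

Lemma Delta0P_ren Q (A : form Q) : Delta0P A -> forall f, Delta0P (ren f A).
Proof.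
  induction 1; intros f; cbn; constructor; auto.
Qed.

Lemma D0_subst P h g : D0 P -> (forall rho n, h rho n = rho (g n)) -> D0 (fun rho => P (h rho)).
Proof.
  intros [A [HA E]] H. exists (ren g A). split; [now apply Delta0P_ren|].
  intros rho. rewrite sat_ren, <- E.
  replace (h rho) with (fun n => rho (g n)); [tauto|].
  apply functional_extensionality. now intros n.
Qed.

Lemma D0_mem i j : D0 (fun rho => rho i ∈ rho j).
Proof. exists (Mem i j). split; [constructor | reflexivity]. Qed.

Lemma D0_eq i j : D0 (fun rho => rho i = rho j).
Proof. exists (Eq i j). split; [constructor | reflexivity]. Qed.

Lemma D0_and P P' : D0 P -> D0 P' -> D0 (fun rho => P rho /\ P' rho).
Proof.
  intros [A [HA E]] [B [HB F]]. exists (And A B). split; [now constructor|].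
  intros rho. cbn. now rewrite E, F.
Qed.

Lemma D0_or P P' : D0 P -> D0 P' -> D0 (fun rho => P rho \/ P' rho).
Proof.
  intros [A [HA E]] [B [HB F]]. exists (Or A B). split; [now constructor|].
  intros rho. cbn. now rewrite E, F.
Qed.

Lemma D0_imp P P' : D0 P -> D0 P' -> D0 (fun rho => P rho -> P' rho).
Proof.
  intros [A [HA E]] [B [HB F]]. exists (Imp A B). split; [now constructor|].
  intros rho. cbn. now rewrite E, F.
Qed.

Lemma D0_iff P P' : D0 P -> D0 P' -> D0 (fun rho => P rho <-> P' rho).
Proof. intros H H'. apply D0_and; now apply D0_imp. Qed.

Lemma D0_not P : D0 P -> D0 (fun rho => ~ P rho).
Proof.
  intros [A [HA E]]. exists (Neg A). split; [now constructor|].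
  intros rho. cbn. now rewrite E.
Qed.

Lemma D0_all_in i P :
  D0 (fun rho => P (rho 0) (fun n => rho (S n))) ->
  D0 (fun rho => forall x, x ∈ rho i -> P x rho).
Proof.
  intros [A [HA E]]. exists (AllIn i A). split; [now constructor|].
  intros rho. split; intros H x Hx; apply (E (scons x rho)); now apply H.
Qed.

Lemma D0_ex_in i P :
  D0 (fun rho => P (rho 0) (fun n => rho (S n))) ->
  D0 (fun rho => exists x, x ∈ rho i /\ P x rho).
Proof.
  intros [A [HA E]]. exists (ExIn i A). split; [now constructor|].
  intros rho. split; intros [x [Hx H]]; exists x; (split; [exact Hx|]); now apply (E (scons x rho)).
Qed.

Lemma D0_all_sub i P :
  D0 (fun rho => P (rho 0) (fun n => rho (S n))) ->
  D0 (fun rho => forall x, Sub x (rho i) -> P x rho).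
Proof.
  intros [A [HA E]]. exists (AllSub i A). split; [now constructor|].
  intros rho. split; intros H x Hx; apply (E (scons x rho)); now apply H.
Qed.

Lemma D0_ex_sub i P :
  D0 (fun rho => P (rho 0) (fun n => rho (S n))) ->
  D0 (fun rho => exists x, Sub x (rho i) /\ P x rho).
Proof.
  intros [A [HA E]]. exists (ExSub i A). split; [now constructor|].
  intros rho. split; intros [x [Hx H]]; exists x; (split; [exact Hx|]); now apply (E (scons x rho)).
Qed.

Lemma D0_Sub i j : D0 (fun rho => Sub (rho i) (rho j)).
Proof. apply D0_all_in. apply D0_mem. Qed.

Lemma Def_D0 P : D0 P -> Def P.
Proof. intros [A [_ E]]. now exists A. Qed.

Lemma Def_and P P' : Def P -> Def P' -> Def (fun rho => P rho /\ P' rho).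
Proof. intros [A [_ E]] [B [_ F]]. exists (And A B). split; [trivial|]. intros rho. cbn. now rewrite E, F. Qed.

Lemma Def_or P P' : Def P -> Def P' -> Def (fun rho => P rho \/ P' rho).
Proof. intros [A [_ E]] [B [_ F]]. exists (Or A B). split; [trivial|]. intros rho. cbn. now rewrite E, F. Qed.

Lemma Def_imp P P' : Def P -> Def P' -> Def (fun rho => P rho -> P' rho).
Proof. intros [A [_ E]] [B [_ F]]. exists (Imp A B). split; [trivial|]. intros rho. cbn. now rewrite E, F. Qed.

Lemma Def_not P : Def P -> Def (fun rho => ~ P rho).
Proof. intros [A [_ E]]. exists (Neg A). split; [trivial|]. intros rho. cbn. now rewrite E. Qed.

Lemma Def_all P :
  Def (fun rho => P (rho 0) (fun n => rho (S n))) -> Def (fun rho => forall x, P x rho).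
Proof.
  intros [A [_ E]]. exists (All A). split; [trivial|].
  intros rho. split; intros H x; apply (E (scons x rho)); apply H.
Qed.

Lemma Def_ex P :
  Def (fun rho => P (rho 0) (fun n => rho (S n))) -> Def (fun rho => exists x, P x rho).
Proof.
  intros [A [_ E]]. exists (Ex A). split; [trivial|].
  intros rho. split; intros [x H]; exists x; now apply (E (scons x rho)).
Qed.

(** * Pairs and the axioms read in the model *)

Definition upair (p a b : M) : Prop := forall w, w ∈ p <-> w = a \/ w = b.
Definition opair (p a b : M) : Prop :=
  exists u v, upair u a a /\ upair v a b /\ upair p u v.
Definition empty (x : M) : Prop := forall u, ~ u ∈ x.
Definition App (f x y : M) : Prop := exists p, p ∈ f /\ opair p x y.

Lemma m_ext x y : (forall u, u ∈ x <-> u ∈ y) -> x = y.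
Proof. exact (model (AC_KPP KPP_ext) (fun _ => x) x y). Qed.

Lemma m_pair a b : exists p, upair p a b.
Proof. exact (model (AC_KPP KPP_pair) (fun _ => a) a b). Qed.

Lemma m_union a : exists z, forall u, u ∈ z <-> exists y, y ∈ a /\ u ∈ y.
Proof. exact (model (AC_KPP KPP_union) (fun _ => a) a). Qed.

Lemma m_pow a : exists z, forall u, u ∈ z <-> Sub u a.
Proof. exact (model (AC_KPP KPP_pow) (fun _ => a) a). Qed.

Lemma m_empty (x : M) : exists e, empty e.
Proof.
  destruct (model (AC_KPP KPP_inf) (fun _ => x)) as [w [[e [_ He]] _]].
  exists e. exact He.
Qed.

Lemma m_sep P rho a : D0 P -> exists z, forall u, u ∈ z <-> u ∈ a /\ P (scons u rho).
Proof.
  intros [A [HA E]].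
  (* In the axiom index 1 is [a]; the renamed formula skips it, so that [P] sees only [u] and
     [rho]. *)
  set (B := ren (fun n => match n with 0 => 0 | S n => S (S n) end) A).
  assert (HB : Delta0P B) by now apply Delta0P_ren.
  destruct (sat_closure mem I (separation B) rho (model (AC_KPP (KPP_sep HB))) a) as [z Hz].
  exists z. intros u. specialize (Hz u). cbn in Hz.
  rewrite sat_ren in Hz. unfold B in Hz. rewrite sat_ren in Hz.
  rewrite E. replace (scons u rho) with (fun n => scons u (scons z (scons a rho))
    (up S (match n with 0 => 0 | S n => S (S n) end))); [exact Hz|].
  apply functional_extensionality. now intros [|n].
Qed.

Lemma m_coll P rho a : D0 P ->
  (forall x, x ∈ a -> exists y, P (scons y (scons x rho))) ->
  exists z, forall x, x ∈ a -> exists y, y ∈ z /\ P (scons y (scons x rho)).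
Proof.
  intros [A [HA E]] H.
  (* Here [a] has index 2 and is skipped in the same way. *)
  set (g := fun n => match n with 0 => 0 | 1 => 1 | S (S n) => S (S (S n)) end).
  assert (HB : Delta0P (ren g A)) by now apply Delta0P_ren.
  assert (Eg : forall y x, (fun n => scons y (scons x (scons a rho)) (g n)) = scons y (scons x rho)).
  { intros y x. apply functional_extensionality. now intros [|[|n]]. }
  destruct (sat_closure mem I (collection (ren g A)) rho (model (AC_KPP (KPP_coll HB))) a) as [z Hz].
  - intros x Hx. destruct (H x Hx) as [y Hy]. exists y.
    apply sat_ren. rewrite Eg. now apply E.
  - exists z. intros x Hx. destruct (Hz x Hx) as [y [Hy Hz']]. exists y. split; [exact Hy|].
    cbn in Hz'. rewrite !sat_ren in Hz'. rewrite E.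
    replace (scons y (scons x rho)) with (fun n => scons y (scons x (scons z (scons a rho))) (up (up S) (g n)));
      [exact Hz'|].
    apply functional_extensionality. now intros [|[|n]].
Qed.

Lemma m_ind P rho : Def P ->
  (forall x, (forall y, y ∈ x -> P (scons y rho)) -> P (scons x rho)) ->
  forall x, P (scons x rho).
Proof.
  intros [A [_ E]] H x. apply E.
  apply (sat_closure mem I (set_induction A) rho (model (AC_KPP (KPP_set_induction A)))).
  intros y Hy. apply E, H. intros w Hw. apply E.
  generalize (Hy w Hw). cbn. rewrite sat_ren, scons_up. auto.
Qed.

Lemma m_union2 a b : exists z, forall u, u ∈ z <-> u ∈ a \/ u ∈ b.
Proof.
  destruct (m_pair a b) as [p Hp]. destruct (m_union p) as [z Hz]. exists z. intros u.
  rewrite Hz. split.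
  - intros [y [Hy Hu]]. apply Hp in Hy as [->| ->]; auto.
  - intros [Hu|Hu]; [exists a | exists b]; (split; [apply Hp; auto | exact Hu]).
Qed.

Lemma Sub_refl x : Sub x x.
Proof. now intros u. Qed.

Lemma Sub_trans x y z : Sub x y -> Sub y z -> Sub x z.
Proof. intros H1 H2 u Hu. auto. Qed.

Lemma D0_upair i j k : D0 (fun rho => upair (rho i) (rho j) (rho k)).
Proof.
  apply definable_iff with (P := fun rho => (rho j ∈ rho i /\ rho k ∈ rho i) /\
    forall w, w ∈ rho i -> w = rho j \/ w = rho k).
  - intros rho. split.
    + intros H. split; [split; apply H; auto | intros w; apply H].
    + intros [[H1 H2] H] w. split; [apply H | intros [->| ->]; auto].
  - apply D0_and; [apply D0_and; apply D0_mem|]. apply D0_all_in. apply D0_or; apply D0_eq with (i := 0).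
Qed.

Lemma D0_opair i j k : D0 (fun rho => opair (rho i) (rho j) (rho k)).
Proof.
  apply definable_iff with (P := fun rho => exists u, u ∈ rho i /\ exists v, v ∈ rho i /\
    upair u (rho j) (rho j) /\ upair v (rho j) (rho k) /\ upair (rho i) u v).
  - intros rho. split.
    + intros (u & v & H1 & H2 & H3). exists u. split; [apply H3; auto|].
      exists v. split; [apply H3|]; auto.
    + intros (u & _ & v & _ & H). now exists u, v.
  - apply D0_ex_in, D0_ex_in. cbv beta. repeat apply D0_and.
    + apply (D0_upair 1 (S (S j)) (S (S j))).
    + apply (D0_upair 0 (S (S j)) (S (S k))).
    + apply (D0_upair (S (S i)) 1 0).
Qed.

Lemma D0_App i j k : D0 (fun rho => App (rho i) (rho j) (rho k)).
Proof. apply D0_ex_in. apply (D0_opair 0 (S j) (S k)). Qed.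

Lemma D0_empty i : D0 (fun rho => empty (rho i)).
Proof.
  apply definable_iff with (P := fun rho => forall u, u ∈ rho i -> ~ u ∈ rho i).
  - intros rho. unfold empty. firstorder.
  - apply D0_all_in, D0_not. apply (D0_mem 0 (S i)).
Qed.

Lemma upair_unique p q a b : upair p a b -> upair q a b -> p = q.
Proof. intros H1 H2. apply m_ext. intros u. split; intros H; [apply H2, H1 | apply H1, H2]; exact H. Qed.

Lemma opair_unique p q a b : opair p a b -> opair q a b -> p = q.
Proof.
  intros (u & v & Hu & Hv & Hp) (u' & v' & Hu' & Hv' & Hq).
  rewrite (upair_unique Hu' Hu), (upair_unique Hv' Hv) in Hq. exact (upair_unique Hp Hq).
Qed.

Lemma upair_inj p a b a' b' : upair p a b -> upair p a' b' ->
  (a = a' /\ b = b') \/ (a = b' /\ b = a').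
Proof.
  intros H1 H2.
  assert (Ha : a = a' \/ a = b') by (apply H2, H1; auto).
  assert (Hb : b = a' \/ b = b') by (apply H2, H1; auto).
  assert (Ha' : a' = a \/ a' = b) by (apply H1, H2; auto).
  assert (Hb' : b' = a \/ b' = b) by (apply H1, H2; auto).
  intuition (subst; auto).
Qed.

Lemma opair_inj p a b a' b' : opair p a b -> opair p a' b' -> a = a' /\ b = b'.
Proof.
  intros (u & v & Hu & Hv & Hp) (u' & v' & Hu' & Hv' & Hq).
  destruct (upair_inj Hp Hq) as [[? ?]|[? ?]]; subst.
  - destruct (upair_inj Hu Hu') as [[? _]|[? _]], (upair_inj Hv Hv') as [[? ?]|[? ?]];
      subst; auto.
  - destruct (upair_inj Hu Hv') as [[? ?]|[? ?]], (upair_inj Hv Hu') as [[? ?]|[? ?]];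
      subst; auto.
Qed.

Lemma opair_exists a b : exists p, opair p a b.
Proof.
  destruct (m_pair a a) as [u Hu], (m_pair a b) as [v Hv], (m_pair u v) as [p Hp].
  exists p, u, v. auto.
Qed.

(** Both {a} and {a, b} are subsets of [d], so they lie in its power set, and the pair lies in the
    next one. *)
Lemma opair_in_pow2 d e e' p a b : (forall u, u ∈ e <-> Sub u d) -> (forall u, u ∈ e' <-> Sub u e) ->
  opair p a b -> a ∈ d -> b ∈ d -> p ∈ e'.
Proof.
  intros He He' (u & v & Hu & Hv & Hp) Ha Hb.
  apply He'. intros w Hw. apply Hp in Hw.
  apply He. intros t Ht. destruct Hw; subst; [apply Hu in Ht | apply Hv in Ht];
    destruct Ht; subst; assumption.
Qed.

(** Both kinds of bounded quantification over such a set stay inside it. *)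
Definition supertransitive (d : M) : Prop :=
  forall x, x ∈ d -> Sub x d /\ forall u, Sub u x -> u ∈ d.

Lemma D0_supertransitive i : D0 (fun rho => supertransitive (rho i)).
Proof.
  apply D0_all_in. apply D0_and; [apply (D0_Sub 0 (S i))|].
  apply D0_all_sub. apply (D0_mem 0 (S (S i))).
Qed.

(** Supertransitivity constrains each member separately, so a union of supertransitive sets inherits
    it from the piece around that member. *)
Lemma supertransitive_cover D :
  (forall u, u ∈ D -> exists d, supertransitive d /\ u ∈ d /\ Sub d D) -> supertransitive D.
Proof.
  intros H x Hx. destruct (H x Hx) as (d & Hd & Hxd & HdD). split.
  - intros u Hu. apply HdD. exact (proj1 (Hd x Hxd) u Hu).
  - intros u Hu. apply HdD. exact (proj2 (Hd x Hxd) u Hu).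
Qed.

Lemma supertransitive_pow d e : supertransitive d -> (forall u, u ∈ e <-> Sub u d) ->
  supertransitive e /\ Sub d e.
Proof.
  intros Hd He.
  assert (Hde : Sub d e) by (intros u Hu; apply He, (Hd u Hu)).
  split; [|exact Hde]. intros x Hx. apply He in Hx. split.
  - intros u Hu. apply Hde, Hx, Hu.
  - intros u Hu. apply He. exact (Sub_trans Hu Hx).
Qed.

(** The bound given by Collection may contain unrelated sets. So [D] is the union of [d0] and of
    those members of members of the bound that are supertransitive. *)
Lemma collect_supertransitive P rho a d0 : D0 P -> supertransitive d0 ->
  (forall x, x ∈ a -> exists d e, supertransitive d /\ P (scons e (scons d (scons x rho)))) ->
  exists D, supertransitive D /\ Sub d0 D /\
    forall x, x ∈ a -> exists d e, supertransitive d /\ Sub d D /\ P (scons e (scons d (scons x rho))).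
Proof.
  intros HP Hd0 H.
  destruct (@m_coll (fun r => exists d, d ∈ r 0 /\ exists e, e ∈ r 0 /\
      (supertransitive d /\ P (scons e (scons d (fun n => r (S n)))))) rho a) as [z Hz].
  - apply D0_ex_in, D0_ex_in. cbv beta. apply D0_and; [apply (D0_supertransitive 1)|].
    apply D0_subst with (P := P) (g := fun n => match n with 0 => 0 | 1 => 1 | S (S n) => S (S (S n)) end)
      (h := fun r => scons (r 0) (scons (r 1) (fun n => r (S (S (S n)))))); [exact HP|].
    now intros r [|[|n]].
  - intros x Hx. destruct (H x Hx) as (d & e & Hd & He).
    (* Collection provides one witness per [x], so [d] and [e] are packed into the unordered pair
       [c]. *)
    destruct (m_pair d e) as [c Hc]. exists c, d. split; [apply Hc; auto|].
    exists e. split; [apply Hc; auto | auto].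
  - destruct (m_union z) as [w Hw]. destruct (m_union w) as [t Ht].
    destruct (@m_sep (fun r => exists d, d ∈ r 1 /\ (supertransitive d /\ r 0 ∈ d)) (fun _ => w) t) as [D1 HD1].
    { apply D0_ex_in, D0_and; [apply (D0_supertransitive 0) | apply (D0_mem 1 0)]. }
    assert (Hin : forall d, d ∈ w -> supertransitive d -> Sub d D1).
    { intros d Hd Hs u Hu. apply HD1. split; [apply Ht; eauto | exists d; auto]. }
    destruct (m_union2 d0 D1) as [D HD]. exists D. splits.
    + apply supertransitive_cover. intros u Hu. apply HD in Hu as [Hu|Hu].
      * exists d0. splits; auto. intros v Hv. apply HD; auto.
      * apply HD1 in Hu as (_ & d & Hd & Hs & Hud). cbn in Hd, Hud. exists d. splits; auto.
        intros v Hv. apply HD. right. exact (Hin d Hd Hs v Hv).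
    + intros u Hu. apply HD; auto.
    + intros x Hx. destruct (Hz x Hx) as (c & Hc & d & Hd & e & _ & Hs & HP').
      exists d, e. cbn in Hd. splits; auto.
      intros u Hu. apply HD. right. apply (Hin d); auto. apply Hw. eauto.
Qed.

(** ∈-induction replaces the cumulative hierarchy: the members of [y] lie in a supertransitive [D],
    so [y] is a subset of [D] and a member of its power set. *)
Lemma supertransitive_above x : exists d, supertransitive d /\ x ∈ d.
Proof.
  apply (@m_ind (fun r => exists d, supertransitive d /\ r 0 ∈ d) (fun _ => x)).
  - apply Def_ex, Def_D0, D0_and; [apply (D0_supertransitive 0) | apply (D0_mem 1 0)].
  - intros y IH. cbn in *.
    destruct (m_empty y) as [d0 Hd0].
    destruct (@collect_supertransitive (fun r => r 2 ∈ r 1) (fun _ => y) y d0) as (D & HD & _ & Hy).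
    + apply D0_mem.
    + intros w Hw. now apply Hd0 in Hw.
    (* The second witness is a dummy. *)
    + intros w Hw. destruct (IH w Hw) as [d [Hd Hwd]]. exists d, d. auto.
    + destruct (m_pow D) as [E HE]. exists E. split; [now apply (@supertransitive_pow D)|].
      apply HE. intros w Hw. destruct (Hy w Hw) as (d & e & _ & HdD & Hwd). now apply HdD.
Qed.

Lemma supertransitive_union2 d d' D : supertransitive d -> supertransitive d' ->
  (forall u, u ∈ D <-> u ∈ d \/ u ∈ d') -> supertransitive D.
Proof.
  intros Hd Hd' HD. apply supertransitive_cover. intros u Hu.
  apply HD in Hu as [Hu|Hu]; [exists d | exists d'];
    splits; auto; intros v Hv; apply HD; auto.
Qed.

Lemma supertransitive_extend d x : supertransitive d ->
  exists D, supertransitive D /\ Sub d D /\ x ∈ D.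
Proof.
  intros Hd. destruct (supertransitive_above x) as [d' [Hd' Hx]].
  destruct (m_union2 d d') as [D HD]. exists D. splits.
  - exact (supertransitive_union2 Hd Hd' HD).
  - intros u Hu. apply HD; auto.
  - apply HD; auto.
Qed.

Lemma supertransitive_extend_env d (rho : nat -> M) n : supertransitive d ->
  exists D, supertransitive D /\ Sub d D /\ forall i, i < n -> rho i ∈ D.
Proof.
  intros Hd. induction n as [|n (D & HD & HdD & Hr)].
  - exists d. splits; auto using Sub_refl. intros; lia.
  - destruct (supertransitive_extend (rho n) HD) as (D' & HD' & Hsub & Hn).
    exists D'. splits; [exact HD' | exact (Sub_trans HdD Hsub)|].
    intros i Hi. destruct (Nat.eq_dec i n) as [->|]; [exact Hn|]. apply Hsub, Hr. lia.
Qed.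

(** Tuples of arbitrary length are coded by nested pairs ending in the empty
    set, so that the length is determined by the code. *)
Fixpoint code (c : M) (l : list M) : Prop :=
  match l with
  | [] => empty c
  | x :: l => exists t, opair c x t /\ code t l
  end.

Lemma opair_not_empty p a b : opair p a b -> ~ empty p.
Proof. intros (u & v & _ & _ & Hp) He. apply (He u), Hp. auto. Qed.

Lemma code_unique l : forall c l', code c l -> code c l' -> l = l'.
Proof.
  induction l as [|x l IH]; intros c [|x' l'] H1 H2; cbn in *; auto.
  - destruct H2 as (t & Ht & _). destruct (opair_not_empty Ht H1).
  - destruct H1 as (t & Ht & _). destruct (opair_not_empty Ht H2).
  - destruct H1 as (t & Ht & Hc), H2 as (t' & Ht' & Hc').
    destruct (opair_inj Ht Ht') as [-> ->]. f_equal. eauto.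
Qed.

Lemma opair_components d p a b : supertransitive d -> p ∈ d -> opair p a b -> a ∈ d /\ b ∈ d.
Proof.
  intros Hd Hp (u & v & Hu & Hv & Huv).
  assert (Hv' : v ∈ d) by (apply (proj1 (Hd p Hp)), Huv; auto).
  split; apply (proj1 (Hd v Hv')), Hv; auto.
Qed.

Lemma code_components d l : supertransitive d -> forall c, c ∈ d -> code c l ->
  forall x, In x l -> x ∈ d.
Proof.
  intros Hd. induction l as [|y l IH]; cbn; [tauto|].
  intros c Hc (t & Ht & Hl) x Hx. destruct (opair_components Hd Hc Ht) as [Hy Htd].
  destruct Hx as [<-|Hx]; [exact Hy | eauto].
Qed.

(** Each component costs two power sets, as in [opair_in_pow2]; the empty tuple costs one. *)
Lemma code_exists d0 n : supertransitive d0 ->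
  exists d, supertransitive d /\ Sub d0 d /\
    forall l, length l = n -> (forall x, In x l -> x ∈ d0) -> exists c, c ∈ d /\ code c l.
Proof.
  intros Hd0. induction n as [|n (d & Hd & Hsub & Hc)].
  - destruct (m_pow d0) as [e He]. destruct (supertransitive_pow Hd0 He) as [H1 H2].
    exists e. splits; auto. intros [|] Hl; [|discriminate].
    destruct (m_empty d0) as [o Ho]. exists o. split; [|exact Ho].
    apply He. intros u Hu. now apply Ho in Hu.
  - destruct (m_pow d) as [e He]. destruct (supertransitive_pow Hd He) as [H1 H2].
    destruct (m_pow e) as [e' He']. destruct (supertransitive_pow H1 He') as [H3 H4].
    exists e'. splits; [exact H3 | exact (Sub_trans Hsub (Sub_trans H2 H4))|].
    intros [|x l] Hl Hin; [discriminate|]. injection Hl as Hl.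
    destruct (Hc l Hl) as (t & Ht & Hcode); [intros; apply Hin; now right|].
    destruct (opair_exists x t) as [c Hct]. exists c. split.
    + apply (opair_in_pow2 He He' Hct); [|exact Ht]. apply Hsub, Hin. now left.
    + now exists t.
Qed.

(** The last entry of [l] becomes index 0. Therefore [prefix] lists an initial segment in descending
    order, so that pushing it restores the segment. *)
Fixpoint pushes (l : list M) (rho : nat -> M) : nat -> M :=
  match l with [] => rho | x :: l => pushes l (scons x rho) end.

Lemma pushes_ge l : forall rho n, pushes l rho (length l + n) = rho n.
Proof.
  induction l as [|x l IH]; intros rho n; cbn; [reflexivity|].
  rewrite <- Nat.add_succ_r. now rewrite IH.
Qed.

Lemma pushes_lt l : forall rho n, n < length l -> In (pushes l rho n) l.
Proof.
  induction l as [|x l IH]; intros rho n Hn; cbn in *; [lia|].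
  destruct (Nat.eq_dec n (length l)) as [->|].
  - left. rewrite <- (Nat.add_0_r (length l)), pushes_ge. reflexivity.
  - right. apply IH. lia.
Qed.

Fixpoint prefix (n : nat) (sigma : nat -> M) : list M :=
  match n with 0 => [] | S n => sigma n :: prefix n sigma end.

Lemma prefix_length n sigma : length (prefix n sigma) = n.
Proof. induction n; cbn; auto. Qed.

Lemma prefix_in n sigma x : In x (prefix n sigma) -> exists i, i < n /\ x = sigma i.
Proof.
  induction n; cbn; [tauto|]. intros [<-|H]; [exists n; auto|].
  destruct (IHn H) as [i [Hi ->]]. exists i. auto.
Qed.

Lemma pushes_prefix n sigma : forall rho k, k < n -> pushes (prefix n sigma) rho k = sigma k.
Proof.
  induction n; intros rho k Hk; [lia|]. cbn.
  destruct (Nat.eq_dec k n) as [->|]; [|apply IHn; lia].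
  rewrite <- (prefix_length n sigma) at 3. rewrite <- (Nat.add_0_r (length _)).
  now rewrite pushes_ge.
Qed.

(** The components of a pair are members of its members, so a quantifier over tuples of fixed length
    unfolds into bounded quantifiers. *)
Lemma D0_code_all n : forall P i g, D0 P ->
  D0 (fun rho => forall l, length l = n -> code (rho i) l -> P (pushes l (fun m => rho (g m)))).
Proof.
  induction n; intros P i g HP.
  - apply definable_iff with (P := fun rho => empty (rho i) -> P (fun m => rho (g m))).
    + intros rho. split; [intros H He; now apply (H [])|].
      intros H [|] Hl; [exact H | discriminate].
    + apply D0_imp; [apply D0_empty|]. now apply D0_subst with (g := g).
  - apply definable_iff with (P := fun rho => forall u, u ∈ rho i -> forall x, x ∈ u ->
      forall v, v ∈ rho i -> forall t, t ∈ v -> opair (rho i) x t ->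
      forall l, length l = n -> code t l -> P (pushes l (scons x (fun m => rho (g m))))).
    + intros rho. split.
      * intros H u _ x _ v _ t _ Hp l Hl Hc. apply (H (x :: l)); cbn; [auto|]. now exists t.
      * intros H [|x l] Hl; [discriminate|]. intros (t & Ht & Hc). injection Hl as Hl.
        destruct Ht as (u & v & Hu & Hv & Hp).
        apply (H u) with (v := v) (t := t); auto; try (apply Hp; now auto);
          [apply Hu | apply Hv | exists u, v]; auto.
    + do 2 (apply D0_all_in; cbv beta). apply (@D0_all_in (S (S i))). apply D0_all_in. cbv beta.
      (* The variables [t], [v], [x], [u] are now the indices 0 to 3. *)
      apply D0_imp; [apply (D0_opair (S (S (S (S i)))) 2 0)|].
      eapply definable_iff; [|apply (IHn P 0
        (fun m => match m with 0 => 2 | S m => S (S (S (S (g m)))) end) HP)].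
      intros rho. cbv beta.
      replace (scons (rho 2) (fun m => rho (S (S (S (S (g m))))))) with
        (fun m => rho match m with 0 => 2 | S m => S (S (S (S (g m)))) end); [reflexivity|].
      apply functional_extensionality. now intros [|m].
Qed.

(** * Approximations of a global choice function *)

(** Agreement as approximations: pairs of [f] with a component outside [d] are ignored. *)
Definition eqv (d f f' : M) : Prop :=
  forall x, x ∈ d -> forall y, y ∈ d -> (App f x y <-> App f' x y).

Lemma eqv_refl d f : eqv d f f.
Proof. intros x Hx y Hy. reflexivity. Qed.

Lemma eqv_sym d f f' : eqv d f f' -> eqv d f' f.
Proof. intros H x Hx y Hy. symmetry. auto. Qed.

Lemma eqv_trans d f f' f'' : eqv d f f' -> eqv d f' f'' -> eqv d f f''.
Proof. intros H H' x Hx y Hy. rewrite (H x Hx y Hy). auto. Qed.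

Lemma eqv_sub d d' f f' : Sub d d' -> eqv d' f f' -> eqv d f f'.
Proof. intros Hd H x Hx y Hy. auto. Qed.

Lemma D0_eqv i j k : D0 (fun rho => eqv (rho i) (rho j) (rho k)).
Proof.
  apply D0_all_in. apply (@D0_all_in (S i)). apply D0_iff.
  - apply (D0_App (S (S j)) 1 0).
  - apply (D0_App (S (S k)) 1 0).
Qed.

Definition choice_on (d f : M) : Prop :=
  (forall x, x ∈ d -> ~ empty x -> exists y, y ∈ x /\ App f x y) /\
  (forall x, x ∈ d -> forall y, y ∈ d -> forall z, z ∈ d -> App f x y -> App f x z -> y = z).

Lemma D0_choice_on i j : D0 (fun rho => choice_on (rho i) (rho j)).
Proof.
  apply D0_and.
  - apply D0_all_in, D0_imp; [apply D0_not, (D0_empty 0)|].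
    apply (@D0_ex_in 0). apply (D0_App (S (S j)) 1 0).
  - apply D0_all_in, (@D0_all_in (S i)), (@D0_all_in (S (S i))). cbv beta. repeat apply D0_imp.
    + apply (D0_App (S (S (S j))) 2 1).
    + apply (D0_App (S (S (S j))) 2 0).
    + apply (D0_eq 1 0).
Qed.

Lemma choice_on_sub d d' f : Sub d d' -> choice_on d' f -> choice_on d f.
Proof. intros Hd [H1 H2]. split; [auto|]. intros x Hx y Hy z Hz. apply H2; auto. Qed.

Lemma choice_on_eqv d f f' : supertransitive d -> eqv d f f' -> choice_on d f -> choice_on d f'.
Proof.
  intros Hd E [H1 H2]. split.
  - intros x Hx Hne. destruct (H1 x Hx Hne) as (y & Hy & HA). exists y. split; [exact Hy|].
    apply E; auto. now apply (proj1 (Hd x Hx)).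
  - intros x Hx y Hy z Hz Ay Az. apply (H2 x Hx y Hy z Hz); now apply E.
Qed.

(** Choice is applied to the set of nonempty members of [d]. A value at any [y] puts [y] into that
    set, where values are unique. *)
Lemma choice_on_exists d : exists f, choice_on d f.
Proof.
  destruct (@m_sep (fun r => ~ empty (r 0)) (fun _ => d) d) as [x Hx].
  { apply D0_not, (D0_empty 0). }
  destruct (model AC_choice (fun _ => d) x) as [f [Hf Hx']].
  { intros y Hy. exact (proj2 (proj1 (Hx y) Hy)). }
  exists f. split.
  - intros y Hy Hne.
    destruct (Hx' y) as (w & Hw & HA & _); [now apply Hx|]. exists w. split; [exact Hw | exact HA].
  - intros y _ z _ w _ Az Aw.
    assert (Hy : y ∈ x).
    { destruct Az as (p & Hp & Hop). destruct (Hf p Hp) as (y' & Hy' & w' & Hop').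
      destruct (opair_inj Hop Hop') as [-> _]. exact Hy'. }
    destruct (Hx' y Hy) as (v & _ & _ & Hv).
    rewrite (Hv z Az : z = v). symmetry. exact (Hv w Aw).
Qed.

(** Then every relation on [d] is given by a subset of [e]. *)
Definition pairs_in (d e : M) : Prop :=
  forall x, x ∈ d -> forall y, y ∈ d -> exists p, p ∈ e /\ opair p x y.

Lemma D0_pairs_in i j : D0 (fun rho => pairs_in (rho i) (rho j)).
Proof.
  apply D0_all_in, (@D0_all_in (S i)), (@D0_ex_in (S (S j))). apply (D0_opair 0 2 1).
Qed.

Lemma pairs_in_exists d : exists e, pairs_in d e.
Proof.
  destruct (m_pow d) as [e He], (m_pow e) as [e' He'].
  exists e'. intros x Hx y Hy. destruct (opair_exists x y) as [p Hp]. exists p.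
  split; [exact (opair_in_pow2 He He' Hp Hx Hy) | exact Hp].
Qed.

(** Makes a quantifier over approximations on [d] a quantifier over subsets of [e], which keeps the
    surrounding predicate in [D0]. *)
Lemma restrict d e f : pairs_in d e -> exists f', Sub f' e /\ eqv d f f'.
Proof.
  intros He. destruct (@m_sep (fun r => r 0 ∈ r 1) (fun _ => f) e (D0_mem 0 1)) as [f' Hf'].
  exists f'. split.
  - intros u Hu. now apply Hf'.
  - intros x Hx y Hy. split; intros (p & Hp & Hop).
    + exists p. split; [|exact Hop]. apply Hf'. split; [|exact Hp].
      destruct (He x Hx y Hy) as (q & Hq & Hoq). now rewrite (opair_unique Hop Hoq).
    + exists p. split; [|exact Hop]. now apply Hf' in Hp.
Qed.

Definition isat (f : M) (rho : nat -> M) (A : form choice_symbol) : Prop :=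
  sat mem (fun _ => App f) rho A.

(** Bounded quantifiers stay in the supertransitive [d], where atoms of [R] depend only on pairs
    from [d]. *)
Lemma isat_eqv d f f' A : Delta0P A -> supertransitive d -> eqv d f f' ->
  forall rho, (forall i, i < fv_bound A -> rho i ∈ d) -> (isat f rho A <-> isat f' rho A).
Proof.
  intros HA Hd Hff. unfold isat.
  induction HA as [i j|i j|r i j|A B _ IHA _ IHB|A B _ IHA _ IHB|A B _ IHA _ IHB|A _ IHA
    |a A _ IHA|a A _ IHA|a A _ IHA|a A _ IHA]; intros rho Hr.
  - reflexivity.
  - reflexivity.
  - apply Hff; apply Hr; cbn [fv_bound]; lia.
  - cbn in *. rewrite IHA, IHB; [reflexivity | |]; intros; apply Hr; lia.
  - cbn in *. rewrite IHA, IHB; [reflexivity | |]; intros; apply Hr; lia.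
  - cbn in *. rewrite IHA, IHB; [reflexivity | |]; intros; apply Hr; lia.
  - cbn in *. now rewrite IHA.
  - assert (E : forall x, x ∈ rho a ->
      (sat mem (fun _ => App f) (scons x rho) A <-> sat mem (fun _ => App f') (scons x rho) A)).
    { intros x Hx. apply IHA. intros [|i] Hi.
      - refine (proj1 (Hd (rho a) _) x Hx). apply Hr. cbn [fv_bound AllIn]. lia.
      - apply Hr. cbn [fv_bound AllIn]. lia. }
    split; intros H x Hx; apply (E x Hx), H, Hx.
  - assert (E : forall x, x ∈ rho a ->
      (sat mem (fun _ => App f) (scons x rho) A <-> sat mem (fun _ => App f') (scons x rho) A)).
    { intros x Hx. apply IHA. intros [|i] Hi.
      - refine (proj1 (Hd (rho a) _) x Hx). apply Hr. cbn [fv_bound ExIn]. lia.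
      - apply Hr. cbn [fv_bound ExIn]. lia. }
    split; intros [x [Hx H]]; exists x; (split; [exact Hx | now apply (E x Hx)]).
  - assert (E : forall x, Sub x (rho a) ->
      (sat mem (fun _ => App f) (scons x rho) A <-> sat mem (fun _ => App f') (scons x rho) A)).
    { intros x Hx. apply IHA. intros [|i] Hi.
      - refine (proj2 (Hd (rho a) _) x Hx). apply Hr. cbn [fv_bound AllSub subset]. lia.
      - apply Hr. cbn [fv_bound AllSub subset]. lia. }
    split; intros H x Hx; apply (E x Hx), H, Hx.
  - assert (E : forall x, Sub x (rho a) ->
      (sat mem (fun _ => App f) (scons x rho) A <-> sat mem (fun _ => App f') (scons x rho) A)).
    { intros x Hx. apply IHA. intros [|i] Hi.
      - refine (proj2 (Hd (rho a) _) x Hx). apply Hr. cbn [fv_bound ExSub subset]. lia.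
      - apply Hr. cbn [fv_bound ExSub subset]. lia. }
    split; intros [x [Hx H]]; exists x; (split; [exact Hx | now apply (E x Hx)]).
Qed.

(** Replacing each atom of [R] by membership of a pair in [f] gives a bounded formula of set theory
    with [f] as a parameter. *)
Lemma D0_isat A : Delta0P A -> forall k g, D0 (fun rho => isat (rho k) (fun n => rho (g n)) A).
Proof.
  assert (E : forall g (rho : nat -> M),
    scons (rho 0) (fun n => rho (S (g n))) = fun n => rho (up g n))
    by (intros; apply functional_extensionality; now intros [|n]).
  unfold isat.
  induction 1 as [i j|i j|r i j|A B _ IHA _ IHB|A B _ IHA _ IHB|A B _ IHA _ IHB|A _ IHA
    |a A _ IHA|a A _ IHA|a A _ IHA|a A _ IHA]; intros k g.
  - apply D0_mem.
  - apply D0_eq.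
  - apply D0_App.
  - apply D0_and; auto.
  - apply D0_or; auto.
  - apply D0_imp; auto.
  - apply D0_not; auto.
  - apply (@D0_all_in (g a) (fun x rho => sat mem (fun _ => App (rho k)) (scons x (fun n => rho (g n))) A)).
    eapply definable_iff; [|exact (IHA (S k) (up g))]. intros rho. now rewrite E.
  - apply (@D0_ex_in (g a) (fun x rho => sat mem (fun _ => App (rho k)) (scons x (fun n => rho (g n))) A)).
    eapply definable_iff; [|exact (IHA (S k) (up g))]. intros rho. now rewrite E.
  - apply (@D0_all_sub (g a) (fun x rho => sat mem (fun _ => App (rho k)) (scons x (fun n => rho (g n))) A)).
    eapply definable_iff; [|exact (IHA (S k) (up g))]. intros rho. now rewrite E.
  - apply (@D0_ex_sub (g a) (fun x rho => sat mem (fun _ => App (rho k)) (scons x (fun n => rho (g n))) A)).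
    eapply definable_iff; [|exact (IHA (S k) (up g))]. intros rho. now rewrite E.
Qed.

(** The [j]-th formula of a list, with its parameters given by a tuple of length
    [n + j], yields the promise that [y] does not satisfy it. *)
Definition promise (Gs : list (form choice_symbol)) (n : nat) (y c f : M) : Prop :=
  forall j A l, nth_error Gs j = Some A -> length l = n + j -> code c l ->
    ~ isat f (scons y (pushes l (scons f (fun _ => y)))) A.

(** Dropping the head of [Gs] raises the tuple length from [n] to [S n], which drives the induction.
    The padding by [f] and [y] in [promise] puts these at indices [n] and [S n] for the tuples of
    the head, where a predicate of the pushed assignment alone can read them. *)
Lemma D0_promise Gs : (forall A, In A Gs -> Delta0P A) -> forall n i j k,
  D0 (fun rho => promise Gs n (rho i) (rho j) (rho k)).
Proof.
  induction Gs as [|A Gs IH]; intros HG n i j k.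
  - apply definable_iff with (P := fun rho => rho 0 = rho 0); [|apply D0_eq].
    intros rho. split; [reflexivity|]. intros _ [|m] A l; discriminate.
  - apply definable_iff with (P := fun rho =>
      (forall l, length l = n -> code (rho j) l ->
         (fun s => ~ isat (s n) (scons (s (S n)) s) A)
           (pushes l (fun m => rho (match m with 0 => k | S _ => i end)))) /\
      promise Gs (S n) (rho i) (rho j) (rho k)).
    + intros rho.
      replace (fun m => rho (match m with 0 => k | S _ => i end)) with (scons (rho k) (fun _ => rho i))
        by (apply functional_extensionality; now intros [|m]).
      assert (E : forall l, length l = n ->
        (isat (pushes l (scons (rho k) (fun _ => rho i)) n)
          (scons (pushes l (scons (rho k) (fun _ => rho i)) (S n)) (pushes l (scons (rho k) (fun _ => rho i)))) A
        <-> isat (rho k) (scons (rho i) (pushes l (scons (rho k) (fun _ => rho i)))) A)).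
      { intros l <-. replace (S (length l)) with (length l + 1) by lia.
        rewrite pushes_ge. rewrite <- (Nat.add_0_r (length l)) at 1. now rewrite pushes_ge. }
      split.
      * intros H. split.
        -- intros l Hl Hc. rewrite (E l Hl). apply (H 0 A l eq_refl); [lia | exact Hc].
        -- intros m B l HB Hl. apply (H (S m) B l HB). lia.
      * intros [H1 H2] [|m] B l HB Hl Hc.
        -- injection HB as <-. assert (Hl' : length l = n) by lia.
           rewrite <- (E l Hl'). now apply H1.
        -- apply (H2 m B l HB); [lia | exact Hc].
    + apply D0_and; [|apply IH; intros; apply HG; now right].
      apply (@D0_code_all n (fun s => ~ isat (s n) (scons (s (S n)) s) A) j
        (fun m => match m with 0 => k | S _ => i end)).
      apply D0_not.
      eapply definable_iff; [|apply (@D0_isat A (HG A (or_introl eq_refl)) n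
        (fun m => match m with 0 => S n | S m => m end))].
      intros s. replace (scons (s (S n)) s) with (fun m => s (match m with 0 => S n | S m => m end));
        [reflexivity|]. apply functional_extensionality; now intros [|m].
Qed.

(** * Keeping promises at a height *)

Section Forcing.
Variables (Gs : list (form choice_symbol)) (K : nat).
Hypothesis Gs_Delta0P : forall A, In A Gs -> Delta0P A.
Hypothesis Gs_bound : forall A, In A Gs -> fv_bound A <= S K.

(** The free variables of the formula denote [y] or components of the tuple coded by [c], and all of
    these lie in [d]. *)
Lemma promise_eqv d f f' y c : supertransitive d -> eqv d f f' -> y ∈ d -> c ∈ d ->
  promise Gs K y c f -> promise Gs K y c f'.
Proof.
  intros Hd E Hy Hc H j A l HA Hl Hcode Hs. apply (H j A l HA Hl Hcode).
  assert (HAin := nth_error_In _ _ HA).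
  assert (Hlt : forall i, i < fv_bound A -> scons y (pushes l (scons f' (fun _ => y))) i ∈ d).
  { intros [|i] Hi; [exact Hy|]. cbn. apply (code_components l Hd Hc Hcode), pushes_lt.
    assert (Hb := Gs_bound A HAin). lia. }
  apply (isat_eqv (Gs_Delta0P A HAin) Hd E) in Hs; [|exact Hlt].
  (* The two assignments differ only in the padding, which starts above the free variables. *)
  clear Hlt. revert Hs. apply sat_agree.
  intros [|i] Hi; [reflexivity|]. cbn. assert (Hb := Gs_bound A HAin).
  assert (Hi' : i < length l) by lia. revert Hi'. generalize (scons f (fun _ => y)) (scons f' (fun _ => y)).
  clear. induction l as [|x l IH]; cbn; [lia|]. intros r r' Hi.
  destruct (Nat.eq_dec i (length l)) as [->|]; [|apply IH; lia].
  rewrite <- (Nat.add_0_r (length l)), !pushes_ge. reflexivity.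
Qed.

(** [P] is a set of codes of parameter tuples. The clause [Sub P d] keeps these parameters in [d],
    so that changing [f] off [d] does not affect the promises. *)
Definition fulfils (d f P : M) : Prop :=
  supertransitive d /\ choice_on d f /\ Sub P d /\
  forall c, c ∈ P -> forall y, y ∈ d -> promise Gs K y c f.

Lemma D0_fulfils i j k : D0 (fun rho => fulfils (rho i) (rho j) (rho k)).
Proof.
  apply D0_and; [|apply D0_and; [|apply D0_and]].
  - apply D0_supertransitive.
  - apply D0_choice_on.
  - apply D0_Sub.
  - apply D0_all_in, (@D0_all_in (S i)). apply (@D0_promise Gs Gs_Delta0P K 0 1 (S (S j))).
Qed.

Lemma fulfils_sub d f P d0 P0 : fulfils d f P -> supertransitive d0 -> Sub d0 d -> Sub P0 P ->
  Sub P0 d0 -> fulfils d0 f P0.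
Proof.
  intros (H1 & H2 & H3 & H4) Hd0 Hd HP HPd. split; [exact Hd0|]. split; [|split; [exact HPd|]].
  - exact (choice_on_sub Hd H2).
  - intros c Hc y Hy. apply H4; auto.
Qed.

Lemma fulfils_eqv d f f' P : fulfils d f P -> eqv d f f' -> fulfils d f' P.
Proof.
  intros (H1 & H2 & H3 & H4) E. split; [exact H1|]. split; [|split; [exact H3|]].
  - exact (choice_on_eqv H1 E H2).
  - intros c Hc y Hy. apply (promise_eqv H1 E Hy (H3 c Hc)). auto.
Qed.

(** The compactness argument behind both the extension lemma and Collection:
    heights [d'] at which every approximation satisfies [P] can be bounded
    uniformly, because approximations at height [d'] can be taken from a power
    set. *)
Lemma uniform_bound P rho a d0 Pi : D0 P -> supertransitive d0 ->
  (forall x d' f f', x ∈ a -> supertransitive d' -> Sub d0 d' -> eqv d' f f' ->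
     P (scons f (scons d' (scons x rho))) -> P (scons f' (scons d' (scons x rho)))) ->
  (forall x, x ∈ a -> exists d', supertransitive d' /\ Sub d0 d' /\
     forall f, fulfils d' f Pi -> P (scons f (scons d' (scons x rho)))) ->
  exists D, supertransitive D /\ Sub d0 D /\
    forall x, x ∈ a -> exists d', supertransitive d' /\ Sub d0 d' /\ Sub d' D /\
      forall f, fulfils d' f Pi -> P (scons f (scons d' (scons x rho))).
Proof.
  intros HP Hd0 Hinv H.
  (* The height [d'] is collected together with a set [e] of pairs, so that [f] can range over
     subsets of [e]. Indices 0 to 4 are [e], [d'], [x], [d0], [Pi]. *)
  destruct (@collect_supertransitive (fun r => (Sub (r 3) (r 1) /\ pairs_in (r 1) (r 0)) /\
      forall f, Sub f (r 0) -> fulfils (r 1) f (r 4) ->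
        P (scons f (scons (r 1) (scons (r 2) (fun n => r (S (S (S (S (S n)))))))))) (scons d0 (scons Pi rho)) a d0)
    as (D & HD & Hsub & HaD).
  - apply D0_and; [apply D0_and; [apply D0_Sub | apply D0_pairs_in]|].
    apply D0_all_sub, D0_imp; [apply (D0_fulfils 2 0 5)|].
    apply D0_subst with (P := P) (h := fun r => scons (r 0) (scons (r 2) (scons (r 3) (fun n => r (S (S (S (S (S (S n)))))))) ))
      (g := fun n => match n with 0 => 0 | 1 => 2 | 2 => 3 | S (S (S n)) => S (S (S (S (S (S n))))) end);
      [exact HP|]. now intros r [|[|[|n]]].
  - exact Hd0.
  - intros x Hx. destruct (H x Hx) as (d' & Hd' & Hdd & Hf).
    destruct (pairs_in_exists d') as [e He]. exists d', e. cbn. splits; auto.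
  - exists D. splits; auto. intros x Hx. destruct (HaD x Hx) as (d' & e & Hd' & HdD & [Hdd He] & Hf).
    (* An arbitrary approximation is exchanged for its restriction, a subset of [e]. *)
    cbn in *. exists d'. splits; auto. intros f Hff. destruct (restrict f He) as (f' & Hf' & E).
    apply Hinv with (f := f'); auto using eqv_sym. apply Hf; [exact Hf' | exact (fulfils_eqv Hff E)].
Qed.

(** * Forcing *)

Record cond : Type := Cond { dom : M; fn : M; prom : M }.

(** The second clause lets the function be redefined outside [dom p] for each height separately. It
    does not ask the extension to satisfy this clause again; that is the content of
    [extend_cond]. *)
Definition good (p : cond) : Prop :=
  fulfils (dom p) (fn p) (prom p) /\
  forall d, Sub (dom p) d -> supertransitive d ->
    exists f, eqv (dom p) (fn p) f /\ fulfils d f (prom p).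

Definition le (q p : cond) : Prop :=
  good q /\ Sub (dom p) (dom q) /\ eqv (dom p) (fn p) (fn q) /\ Sub (prom p) (prom q).

Lemma le_refl p : good p -> le p p.
Proof. intros H. split; [exact H|]. split; [apply Sub_refl|]. split; [apply eqv_refl | apply Sub_refl]. Qed.

Lemma le_trans r q p : le r q -> le q p -> le r p.
Proof.
  intros (Hr & H1 & H2 & H3) (_ & H4 & H5 & H6). split; [exact Hr|].
  split; [exact (Sub_trans H4 H1)|]. split; [|exact (Sub_trans H6 H3)].
  exact (eqv_trans H5 (eqv_sub H4 H2)).
Qed.

Lemma le_good q p : le q p -> good q.
Proof. now intros []. Qed.

Lemma good_supertransitive p : good p -> supertransitive (dom p).
Proof. now intros [[] _]. Qed.

(** If every subset [x] of [e] failed as the new function, each failure would show at some height,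
    and one height [D] would bound them all. An approximation at [D], restricted to [e], contradicts
    this. *)
Lemma extend_cond p d : good p -> supertransitive d -> Sub (dom p) d ->
  exists f, le (Cond d f (prom p)) p.
Proof.
  intros [Hp Hext] Hd Hpd. apply NNPP. intros Hno.
  destruct (pairs_in_exists d) as [e He]. destruct (m_pow e) as [a Ha].
  assert (HPd : Sub (prom p) d) by exact (Sub_trans (proj1 (proj2 (proj2 Hp))) Hpd).
  (* The predicate says that [f] at height [d'] does not certify [x]. Indices 0 to 6 are [f], [d'],
     [x], [d] and the three components of [p]. *)
  destruct (@uniform_bound (fun r => ~ (eqv (r 3) (r 0) (r 2) /\ eqv (r 4) (r 5) (r 2) /\ fulfils (r 3) (r 2) (r 6)))
    (scons d (scons (dom p) (scons (fn p) (fun _ => prom p)))) a d (prom p)) as (D & HD & HdD & Hbound).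
  - apply D0_not, D0_and; [apply D0_eqv|]. apply D0_and; [apply D0_eqv | apply D0_fulfils].
  - exact Hd.
  - cbn. intros x d' f f' _ _ Hsub E H (H1 & H2 & H3). apply H.
    split; [exact (eqv_trans (eqv_sub Hsub E) H1) | auto].
  - cbn. intros x Hx. apply NNPP. intros Hnx.
    (* If [x] fails on [d] itself, the height [d] shows it. *)
    assert (Hgood : eqv (dom p) (fn p) x /\ fulfils d x (prom p)).
    { apply NNPP. intros Hn. apply Hnx. exists d. splits; auto using Sub_refl. tauto. }
    apply Hno. exists x. destruct Hgood as [Hx1 Hx2].
    split; [|split; [exact Hpd | split; [exact Hx1 | apply Sub_refl]]].
    split; [exact Hx2|]. cbn. intros d2 Hd2 Hs2. apply NNPP. intros Hn2.
    apply Hnx. exists d2. splits; auto. intros f Hf (H1 & _). apply Hn2. exists f. auto using eqv_sym.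
  - destruct (Hext D (Sub_trans Hpd HdD) HD) as (f & Hf & HfD).
    destruct (restrict f He) as (x & Hxe & Hfx).
    destruct (Hbound x) as (d' & Hd' & Hdd' & HdD' & Hcontra); [now apply Ha|]. cbn in Hcontra.
    apply (Hcontra f).
    + apply (fulfils_sub HfD Hd' HdD' (Sub_refl (x := _))). exact (Sub_trans HPd Hdd').
    + split; [exact Hfx|]. split; [exact (eqv_trans Hf (eqv_sub Hpd Hfx))|].
      apply fulfils_eqv with (f := f); [|exact Hfx].
      exact (fulfils_sub HfD Hd HdD (Sub_refl (x := _)) HPd).
Qed.

Lemma extend_cond_in p x : good p -> exists q, le q p /\ x ∈ dom q.
Proof.
  intros Hp. destruct (supertransitive_extend x (good_supertransitive Hp)) as (d & Hd & Hsub & Hx).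
  destruct (extend_cond Hp Hd Hsub) as [f Hf]. now exists (Cond d f (prom p)).
Qed.

Lemma extend_cond_env p (rho : nat -> M) n : good p ->
  exists q, le q p /\ forall i, i < n -> rho i ∈ dom q.
Proof.
  intros Hp. destruct (supertransitive_extend_env rho n (good_supertransitive Hp)) as (d & Hd & Hsub & Hx).
  destruct (extend_cond Hp Hd Hsub) as [f Hf]. now exists (Cond d f (prom p)).
Qed.

(** Without promises, AC supplies an approximation at every height, and over the empty domain
    agreement is vacuous. *)
Lemma good_exists (x : M) : exists p, good p.
Proof.
  destruct (m_empty x) as [o Ho].
  assert (Ho' : forall z, Sub o z) by (intros z u Hu; now apply Ho in Hu).
  assert (F : forall d, supertransitive d -> exists f, fulfils d f o).
  { intros d Hd. destruct (choice_on_exists d) as [f Hf]. exists f.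
    split; [exact Hd|]. split; [exact Hf|]. split; [apply Ho'|]. intros c Hc. now apply Ho in Hc. }
  destruct (F o) as [f Hf]; [intros u Hu; now apply Ho in Hu|].
  exists (Cond o f o). split; [exact Hf|]. cbn. intros d _ Hd.
  destruct (F d Hd) as [f' Hf']. exists f'. split; [|exact Hf'].
  intros u Hu. now apply Ho in Hu.
Qed.

(** Weak forcing over an unchanged universe: the clauses for ∨ and ∃ ask for density. An atom of [R]
    is judged only at conditions whose domain contains both arguments, so it can be forced before
    they enter the domain. *)
Fixpoint forces (A : form choice_symbol) (p : cond) (rho : nat -> M) : Prop :=
  match A with
  | Mem i j => rho i ∈ rho j
  | Eq i j => rho i = rho j
  | Rel r i j =>
      forall q, le q p -> rho i ∈ dom q -> rho j ∈ dom q -> App (fn q) (rho i) (rho j)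
  | And A B => forces A p rho /\ forces B p rho
  | Or A B => forall q, le q p -> exists r, le r q /\ (forces A r rho \/ forces B r rho)
  | Imp A B => forall q, le q p -> forces A q rho -> forces B q rho
  | Neg A => forall q, le q p -> ~ forces A q rho
  | All A => forall x, forces A p (scons x rho)
  | Ex A => forall q, le q p -> exists r, le r q /\ exists x, forces A r (scons x rho)
  end.

Lemma forces_mono A : forall p q rho, le q p -> forces A p rho -> forces A q rho.
Proof.
  induction A; cbn; intros p q' rho Hq H; eauto using le_trans.
  destruct H; eauto.
Qed.

(** Double negation elimination and the eliminations of ∨ and ∃ rest on this. For an atom of [R], a
    condition below [q'] agrees with [q'] on its domain. *)
Lemma forces_dense A : forall p rho, good p ->
  (forall q, le q p -> exists r, le r q /\ forces A r rho) -> forces A p rho.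
Proof.
  induction A; cbn; intros p rho Hp H.
  - destruct (H p (le_refl Hp)) as (r & _ & Hr). exact Hr.
  - destruct (H p (le_refl Hp)) as (r & _ & Hr). exact Hr.
  - intros q' Hq Hi Hj. destruct (H q' Hq) as (r & (Hr & Hd & E & HP) & HA).
    apply E; auto. apply HA; auto using le_refl.
  - split; [apply IHA1 | apply IHA2]; auto; intros q Hq;
      destruct (H q Hq) as (r & Hr & HA); exists r; tauto.
  - intros q Hq. destruct (H q Hq) as (r & Hr & HA).
    destruct (HA r (le_refl (le_good Hr))) as (s & Hs & HB). exists s. eauto using le_trans.
  - intros q Hq HA1. apply IHA2; [exact (le_good Hq)|]. intros q' Hq'.
    destruct (H q' (le_trans Hq' Hq)) as (r & Hr & HA). exists r. split; [exact Hr|].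
    apply HA; [exact (le_refl (le_good Hr))|]. exact (forces_mono A1 _ (le_trans Hr Hq') HA1).
  - intros q Hq HA. destruct (H q Hq) as (r & Hr & HN).
    exact (HN r (le_refl (le_good Hr)) (forces_mono A _ Hr HA)).
  - intros x. apply IHA; [exact Hp|]. intros q Hq. destruct (H q Hq) as (r & Hr & HA). eauto.
  - intros q Hq. destruct (H q Hq) as (r & Hr & HA).
    destruct (HA r (le_refl (le_good Hr))) as (s & Hs & HB). exists s. eauto using le_trans.
Qed.

Lemma forces_ren A : forall f p rho, forces (ren f A) p rho <-> forces A p (fun n => rho (f n)).
Proof.
  induction A; cbn; intros f p rho; try tauto.
  - now rewrite IHA1, IHA2.
  - split; intros H q Hq; destruct (H q Hq) as (r & Hr & HA); exists r; (split; [exact Hr|]);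
      rewrite ?IHA1, ?IHA2 in *; exact HA.
  - split; intros H q Hq; specialize (H q Hq); rewrite ?IHA1, ?IHA2 in *; exact H.
  - split; intros H q Hq; specialize (H q Hq); rewrite ?IHA in *; exact H.
  - split; intros H x; specialize (H x); rewrite ?IHA, ?scons_up in *; exact H.
  - split; intros H q Hq; destruct (H q Hq) as (r & Hr & x & HA); exists r; (split; [exact Hr|]);
      exists x; rewrite ?IHA, ?scons_up in *; exact HA.
Qed.

Lemma forces_shift A p x rho : forces (shift A) p (scons x rho) <-> forces A p rho.
Proof. exact (forces_ren A S p (scons x rho)). Qed.

Lemma forces_inst A p t rho : forces (inst t A) p rho <-> forces A p (scons (rho t) rho).
Proof.
  unfold inst. rewrite forces_ren.
  replace (scons (rho t) rho) with (fun n => rho match n with 0 => t | S m => m end); [reflexivity|].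
  apply functional_extensionality. now intros [|n].
Qed.

Lemma forces_sound (T : theory choice_symbol) :
  (forall X, T X -> forall p rho, good p -> forces X p rho) ->
  forall G A, derivable T G A -> forall p rho, good p ->
    (forall X, In X G -> forces X p rho) -> forces A p rho.
Proof.
  intros HT G A D.
  assert (Hmono : forall G p q rho, le q p -> (forall X, In X G -> forces X p rho) ->
    forall X, In X G -> forces X q rho)
    by (intros; eauto using forces_mono).
  assert (Hcons : forall G B q rho, (forall X, In X G -> forces X q rho) -> forces B q rho ->
    forall X, In X (B :: G) -> forces X q rho)
    by (intros G0 B q rho HG HB X [<-|HX]; auto).
  assert (Hshift : forall G p x rho, (forall X, In X G -> forces X p rho) ->
    forall X, In X (map shift G) -> forces X p (scons x rho)).
  { intros G0 p x rho HG X HX. apply in_map_iff in HX as (Y & <- & HY). apply forces_shift. auto. }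
  induction D; intros p rho Hp HG.
  - auto.
  - auto.
  - split; auto.
  - now apply (IHD p rho Hp HG).
  - now apply (IHD p rho Hp HG).
  - intros q Hq. exists q. split; [exact (le_refl (le_good Hq))|]. left.
    apply IHD; [exact (le_good Hq) | eauto].
  - intros q Hq. exists q. split; [exact (le_refl (le_good Hq))|]. right.
    apply IHD; [exact (le_good Hq) | eauto].
  - apply forces_dense; [exact Hp|]. intros q Hq.
    destruct (IHD1 p rho Hp HG q Hq) as (r & Hr & HAB). exists r. split; [exact Hr|].
    destruct HAB as [HA|HB]; [apply IHD2 | apply IHD3]; eauto using le_good, le_trans.
  - intros q Hq HA. apply IHD; eauto using le_good.
  - exact (IHD1 p rho Hp HG p (le_refl Hp) (IHD2 p rho Hp HG)).
  - intros q Hq HA.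
    assert (HG' : forall X, In X (A :: G) -> forces X q rho) by eauto.
    assert (Hg := le_good Hq).
    exact (IHD2 q rho Hg HG' q (le_refl Hg) (IHD1 q rho Hg HG')).
  - destruct (IHD2 p rho Hp HG p (le_refl Hp)). exact (IHD1 p rho Hp HG).
  - apply forces_dense; [exact Hp|]. intros q Hq. apply NNPP. intros HN.
    apply (IHD p rho Hp HG q Hq). intros r Hr HA. exact (HN (ex_intro _ r (conj Hr HA))).
  - intros x. exact (IHD p (scons x rho) Hp (Hshift G p x rho HG)).
  - apply forces_inst. apply (IHD p rho Hp HG).
  - intros q Hq. exists q. split; [exact (le_refl (le_good Hq))|].
    exists (rho t). apply forces_inst. apply IHD; eauto using le_good.
  - apply forces_dense; [exact Hp|]. intros q Hq.
    destruct (IHD1 p rho Hp HG q Hq) as (r & Hr & x & HA). exists r. split; [exact Hr|].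
    apply (forces_shift B r x). apply IHD2; eauto using le_good, le_trans.
  - reflexivity.
  - apply forces_inst. assert (E : rho i = rho j) by exact (IHD1 p rho Hp HG). rewrite <- E.
    apply forces_inst. auto.
Qed.

(** Without [R] no atom depends on the condition, so the quantifiers over extensions collapse. *)
Lemma forces_add_R (A : set_form) : forall p rho, good p -> (forces (add_R A) p rho <-> sat mem I rho A).
Proof.
  unfold add_R.
  induction A as [i j|i j|[]|A IHA B IHB|A IHA B IHB|A IHA B IHB|A IHA|A IHA|A IHA];
    cbn [forces sat map_rel]; intros p rho Hp.
  - reflexivity.
  - reflexivity.
  - now rewrite IHA, IHB.
  - split.
    + intros H. destruct (H p (le_refl Hp)) as (r & Hr & HAB).
      rewrite IHA, IHB in HAB by exact (le_good Hr). exact HAB.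
    + intros H q Hq. exists q. split; [exact (le_refl (le_good Hq))|].
      rewrite IHA, IHB by exact (le_good Hq). exact H.
  - split.
    + intros H HA. apply (IHB p rho Hp), (H p (le_refl Hp)), (IHA p rho Hp), HA.
    + intros H q Hq HA. apply (IHB q rho (le_good Hq)), H, (IHA q rho (le_good Hq)), HA.
  - split.
    + intros H HA. apply (H p (le_refl Hp)), (IHA p rho Hp), HA.
    + intros H q Hq HA. apply H, (IHA q rho (le_good Hq)), HA.
  - split; intros H x; apply (IHA p _ Hp), H.
  - split.
    + intros H. destruct (H p (le_refl Hp)) as (r & Hr & x & HA). exists x.
      exact (proj1 (IHA r _ (le_good Hr)) HA).
    + intros [x H] q Hq. exists q. split; [exact (le_refl (le_good Hq))|]. exists x.
      exact (proj2 (IHA q _ (le_good Hq)) H).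
Qed.

Lemma forces_subset p rho i j : good p -> (forces (subset i j) p rho <-> Sub (rho i) (rho j)).
Proof. exact (forces_add_R (subset i j) rho). Qed.

Lemma isat_le A p q rho : Delta0P A -> good p -> (forall i, i < fv_bound A -> rho i ∈ dom p) ->
  le q p -> (isat (fn q) rho A <-> isat (fn p) rho A).
Proof.
  intros HA Hp Hr (_ & _ & E & _). symmetry.
  exact (isat_eqv HA (good_supertransitive Hp) E rho Hr).
Qed.

(** Once the free variables lie in [dom p], extensions of [p] do not change the truth value, so
    quantifiers over them collapse; bounded quantifiers keep new values in [dom p]. *)
Lemma forces_Delta0P A : Delta0P A -> forall p rho, good p ->
  (forall i, i < fv_bound A -> rho i ∈ dom p) -> (forces A p rho <-> isat (fn p) rho A).
Proof.
  assert (Hup : forall n p q (rho : nat -> M), (forall i, i < n -> rho i ∈ dom p) -> le q p ->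
    forall i, i < n -> rho i ∈ dom q)
    by (intros n p q rho H (_ & Hs & _) i Hi; auto).
  induction 1 as [i j|i j|r i j|A B HA IHA HB IHB|A B HA IHA HB IHB|A B HA IHA HB IHB|A HA IHA
    |a A HA IHA|a A HA IHA|a A HA IHA|a A HA IHA]; intros p rho Hp Hr.
  - reflexivity.
  - reflexivity.
  - cbn [fv_bound] in Hr. assert (Hi : rho i ∈ dom p) by (apply Hr; lia).
    assert (Hj : rho j ∈ dom p) by (apply Hr; lia). split.
    + intros H. exact (H p (le_refl Hp) Hi Hj).
    + intros H q (_ & _ & E & _) _ _. now apply E.
  - cbn [fv_bound] in Hr. cbn. rewrite IHA, IHB; [reflexivity|auto|..|auto|]; intros; apply Hr; lia.
  - cbn [fv_bound] in Hr.
    assert (HrA : forall i, i < fv_bound A -> rho i ∈ dom p) by (intros; apply Hr; lia).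
    assert (HrB : forall i, i < fv_bound B -> rho i ∈ dom p) by (intros; apply Hr; lia).
    split.
    + intros H. destruct (H p (le_refl Hp)) as (q & Hq & HAB).
      rewrite (IHA q), (IHB q) in HAB by eauto using le_good.
      rewrite (isat_le rho HA Hp HrA Hq), (isat_le rho HB Hp HrB Hq) in HAB. exact HAB.
    + intros H q Hq. exists q. split; [exact (le_refl (le_good Hq))|].
      rewrite (IHA q), (IHB q) by eauto using le_good.
      rewrite (isat_le rho HA Hp HrA Hq), (isat_le rho HB Hp HrB Hq). exact H.
  - cbn [fv_bound] in Hr.
    assert (HrA : forall i, i < fv_bound A -> rho i ∈ dom p) by (intros; apply Hr; lia).
    assert (HrB : forall i, i < fv_bound B -> rho i ∈ dom p) by (intros; apply Hr; lia).
    split.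
    + intros H HsA. apply (IHB p rho Hp HrB), (H p (le_refl Hp)), (IHA p rho Hp HrA), HsA.
    + intros H q Hq. rewrite (IHA q), (IHB q) by eauto using le_good.
      rewrite (isat_le rho HA Hp HrA Hq), (isat_le rho HB Hp HrB Hq). exact H.
  - cbn [fv_bound] in Hr. split.
    + intros H HsA. apply (H p (le_refl Hp)), (IHA p rho Hp Hr), HsA.
    + intros H q Hq. rewrite (IHA q) by eauto using le_good.
      rewrite (isat_le rho HA Hp Hr Hq). exact H.
  - cbn [fv_bound AllIn] in Hr.
    assert (Hx : forall x, x ∈ rho a -> forall i, i < fv_bound A -> scons x rho i ∈ dom p).
    { intros x Hx [|i] Hi; [|apply Hr; lia].
      refine (proj1 (good_supertransitive Hp (x := rho a) _) x Hx). apply Hr; lia. }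
    split.
    + intros H x Hxa. apply (IHA p _ Hp (Hx x Hxa)), (H x p (le_refl Hp) Hxa).
    + intros H x q Hq Hxa. apply IHA; eauto using le_good.
      apply (isat_le _ HA Hp (Hx x Hxa) Hq), H, Hxa.
  - cbn [fv_bound ExIn] in Hr.
    assert (Hx : forall x, x ∈ rho a -> forall i, i < fv_bound A -> scons x rho i ∈ dom p).
    { intros x Hx [|i] Hi; [|apply Hr; lia].
      refine (proj1 (good_supertransitive Hp (x := rho a) _) x Hx). apply Hr; lia. }
    split.
    + intros H. destruct (H p (le_refl Hp)) as (q & Hq & x & Hxa & HxA). exists x. split; [exact Hxa|].
      apply IHA in HxA; eauto using le_good. exact (proj1 (isat_le _ HA Hp (Hx x Hxa) Hq) HxA).
    + intros [x [Hxa HxA]] q Hq. exists q. split; [exact (le_refl (le_good Hq))|]. exists x.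
      split; [exact Hxa|]. apply IHA; eauto using le_good.
      exact (proj2 (isat_le _ HA Hp (Hx x Hxa) Hq) HxA).
  - cbn [fv_bound AllSub subset] in Hr.
    assert (Hx : forall x, Sub x (rho a) -> forall i, i < fv_bound A -> scons x rho i ∈ dom p).
    { intros x Hx [|i] Hi; [|apply Hr; lia].
      refine (proj2 (good_supertransitive Hp (x := rho a) _) x Hx). apply Hr; lia. }
    split.
    + intros H x Hxa. apply (IHA p _ Hp (Hx x Hxa)), (H x p (le_refl Hp)).
      now apply (forces_subset (scons x rho) 0 (S a) Hp).
    + intros H x q Hq Hxa. apply (forces_subset (scons x rho) 0 (S a) (le_good Hq)) in Hxa.
      apply IHA; eauto using le_good.
      apply (isat_le _ HA Hp (Hx x Hxa) Hq), H, Hxa.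
  - cbn [fv_bound ExSub subset] in Hr.
    assert (Hx : forall x, Sub x (rho a) -> forall i, i < fv_bound A -> scons x rho i ∈ dom p).
    { intros x Hx [|i] Hi; [|apply Hr; lia].
      refine (proj2 (good_supertransitive Hp (x := rho a) _) x Hx). apply Hr; lia. }
    split.
    + intros H. destruct (H p (le_refl Hp)) as (q & Hq & x & Hxa & HxA).
      apply (forces_subset (scons x rho) 0 (S a) (le_good Hq)) in Hxa. exists x. split; [exact Hxa|].
      apply IHA in HxA; eauto using le_good. exact (proj1 (isat_le _ HA Hp (Hx x Hxa) Hq) HxA).
    + intros [x [Hxa HxA]] q Hq. exists q. split; [exact (le_refl (le_good Hq))|]. exists x.
      split; [now apply (forces_subset (scons x rho) 0 (S a) (le_good Hq))|].
      apply IHA; eauto using le_good.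
      exact (proj2 (isat_le _ HA Hp (Hx x Hxa) Hq) HxA).
Qed.

(** * Definability of forcing and the forced axioms *)

Definition cond_at (i j k : nat) (rho : nat -> M) : cond := Cond (rho i) (rho j) (rho k).

Lemma Def_good i j k : Def (fun rho => good (cond_at i j k rho)).
Proof.
  apply Def_and; [apply Def_D0, D0_fulfils|].
  apply Def_all, Def_imp; [apply Def_D0, (D0_Sub (S i) 0)|].
  apply Def_imp; [apply Def_D0, (D0_supertransitive 0)|].
  apply Def_ex, Def_D0, D0_and; [apply (D0_eqv (S (S i)) (S (S j)) 0) | apply (D0_fulfils 1 0 (S (S k)))].
Qed.

Lemma Def_le i j k i' j' k' : Def (fun rho => le (cond_at i j k rho) (cond_at i' j' k' rho)).
Proof.
  apply Def_and; [apply Def_good|]. apply Def_D0, D0_and; [apply D0_Sub|].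
  apply D0_and; [apply D0_eqv | apply D0_Sub].
Qed.

Lemma Def_all_cond (P : cond -> (nat -> M) -> Prop) :
  Def (fun rho => P (cond_at 2 1 0 rho) (fun n => rho (S (S (S n))))) ->
  Def (fun rho => forall q, P q rho).
Proof.
  intros H. apply definable_iff with (P := fun rho => forall d f s, P (Cond d f s) rho).
  - intros rho. split; [auto | intros F [d f s]; auto].
  - do 3 (apply Def_all; cbv beta). exact H.
Qed.

Lemma Def_ex_cond (P : cond -> (nat -> M) -> Prop) :
  Def (fun rho => P (cond_at 2 1 0 rho) (fun n => rho (S (S (S n))))) ->
  Def (fun rho => exists q, P q rho).
Proof.
  intros H. apply definable_iff with (P := fun rho => exists d f s, P (Cond d f s) rho).
  - intros rho. split; [intros [[d f s] F]; eauto | intros (d & f & s & F); eauto].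
  - do 3 (apply Def_ex; cbv beta). exact H.
Qed.

(** [good] quantifies over all heights, so the defining formula is not bounded; Set Induction
    accepts it all the same. The newest condition always occupies indices 2, 1, 0. *)
Lemma Def_forces A : forall i j k g,
  Def (fun rho => forces A (cond_at i j k rho) (fun n => rho (g n))).
Proof.
  induction A as [i0 j0|i0 j0|r i0 j0|A IHA B IHB|A IHA B IHB|A IHA B IHB|A IHA|A IHA|A IHA];
    intros i j k g; cbn [forces].
  - apply Def_D0, D0_mem.
  - apply Def_D0, D0_eq.
  - apply Def_all_cond. apply Def_imp; [apply (Def_le 2 1 0 (3 + i) (3 + j) (3 + k))|].
    apply Def_D0. apply D0_imp; [apply (D0_mem (3 + g i0) 2)|].
    apply D0_imp; [apply (D0_mem (3 + g j0) 2)|]. apply (D0_App 1 (3 + g i0) (3 + g j0)).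
  - apply Def_and; auto.
  - apply Def_all_cond. apply Def_imp; [apply (Def_le 2 1 0 (3 + i) (3 + j) (3 + k))|].
    apply Def_ex_cond. apply Def_and; [apply (Def_le 2 1 0 5 4 3)|].
    apply Def_or; [apply (IHA 2 1 0 (fun n => 6 + g n)) | apply (IHB 2 1 0 (fun n => 6 + g n))].
  - apply Def_all_cond. apply Def_imp; [apply (Def_le 2 1 0 (3 + i) (3 + j) (3 + k))|].
    apply Def_imp; [apply (IHA 2 1 0 (fun n => 3 + g n)) | apply (IHB 2 1 0 (fun n => 3 + g n))].
  - apply Def_all_cond. apply Def_imp; [apply (Def_le 2 1 0 (3 + i) (3 + j) (3 + k))|].
    apply Def_not. apply (IHA 2 1 0 (fun n => 3 + g n)).
  - apply Def_all.
    eapply definable_iff; [|apply (IHA (S i) (S j) (S k) (fun n => match n with 0 => 0 | S n => 1 + g n end))].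
    intros rho. cbv beta.
    match goal with |- forces _ _ ?e1 <-> forces _ _ ?e2 => replace e1 with e2; [reflexivity|] end.
    apply functional_extensionality; now intros [|n].
  - apply Def_all_cond. apply Def_imp; [apply (Def_le 2 1 0 (3 + i) (3 + j) (3 + k))|].
    apply Def_ex_cond. apply Def_and; [apply (Def_le 2 1 0 5 4 3)|].
    apply Def_ex.
    eapply definable_iff; [|apply (IHA 3 2 1 (fun n => match n with 0 => 0 | S n => 1 + (6 + g n) end))].
    intros rho. cbv beta.
    match goal with |- forces _ _ ?e1 <-> forces _ _ ?e2 => replace e1 with e2; [reflexivity|] end.
    apply functional_extensionality; now intros [|n].
Qed.

Lemma forces_closure A p : (forall rho, forces A p rho) -> forall rho, forces (closure A) p rho.
Proof.
  unfold closure. intros H. induction (fv_bound A) as [|n IH]; [exact H|].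
  intros rho x. apply IH.
Qed.

(** A condition whose domain contains [a] and the parameters decides the formula at every member of
    [a], so the subset cut out by its function in the ground model is the required set. *)
Lemma forces_separation A p rho : Delta0P A -> good p -> forces (separation A) p rho.
Proof.
  intros HA Hp a q Hq.
  (* The successor puts [a] itself into the domain even if the bound of [A] is 0. *)
  destruct (extend_cond_env (scons a rho) (S (fv_bound A)) (le_good Hq)) as (r & Hr & Henv).
  destruct (@m_sep (fun s => isat (s 1) (scons (s 0) (fun n => s (S (S n)))) A)
    (scons (fn r) (scons a rho)) a) as [z Hz].
  { eapply definable_iff; [|apply (@D0_isat A HA 1 (fun n => match n with 0 => 0 | S n => S (S n) end))].
    intros s. replace (scons (s 0) (fun n => s (S (S n)))) with
      (fun n => s (match n with 0 => 0 | S n => S (S n) end)); [reflexivity|].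
    apply functional_extensionality. now intros [|n]. }
  cbn in Hz. exists r. split; [exact Hr|]. exists z. intros u.
  assert (Ha : a ∈ dom r) by (apply (Henv 0); lia).
  assert (Hu : u ∈ a -> forall i, i < fv_bound A -> scons u (scons a rho) i ∈ dom r).
  { intros Hu [|i] Hi; [exact (proj1 (good_supertransitive (le_good Hr) Ha) u Hu)|].
    apply Henv. lia. }
  assert (E : forall s, le s r -> u ∈ a ->
    (forces (ren (up S) A) s (scons u (scons z (scons a rho))) <-> isat (fn r) (scons u (scons a rho)) A)).
  { intros s Hs Hua. rewrite forces_ren, scons_up.
    change (fun n => scons z (scons a rho) (S n)) with (scons a rho).
    rewrite (forces_Delta0P HA).
    - exact (isat_le _ HA (le_good Hr) (Hu Hua) Hs).
    - exact (le_good Hs).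
    - intros i Hi. apply Hs. now apply Hu. }
  split.
  - intros s Hs Huz. apply Hz in Huz as [Hua HuA]. split; [exact Hua|]. now apply E.
  - intros s Hs [Hua HuA]. apply Hz. split; [exact Hua|]. now apply (E s Hs Hua).
Qed.

(** Ground-model induction on [x] with the condition fixed, for the definable predicate that this
    condition forces [A] at [x]. *)
Lemma forces_set_induction A p rho : good p -> forces (set_induction A) p rho.
Proof.
  intros Hp [d f t] Hq Hind.
  change (forall x, forces A (Cond d f t) (scons x rho)).
  apply (@m_ind (fun s => forces A (cond_at 1 2 3 s) (scons (s 0) (fun n => s (4 + n))))
    (scons d (scons f (scons t rho)))).
  - eapply definable_iff; [|apply (Def_forces A 1 2 3 (fun n => match n with 0 => 0 | S n => 4 + n end))].
    intros s. replace (scons (s 0) (fun n => s (4 + n))) with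
      (fun n => s (match n with 0 => 0 | S n => 4 + n end)); [reflexivity|].
    apply functional_extensionality. now intros [|n].
  - intros x IH. apply (Hind x (Cond d f t) (le_refl (le_good Hq))).
    intros y r Hr Hy. apply forces_ren. rewrite scons_up. apply (forces_mono A _ Hr), IH, Hy.
Qed.

Lemma forces_R_functional p rho : good p -> forces R_functional p rho.
Proof.
  intros Hp x y z q Hq [Hy Hz].
  destruct (extend_cond_env (scons x (scons y (scons z rho))) 3 (le_good Hq)) as (r & Hr & Henv).
  assert (Hx' : x ∈ dom r) by (apply (Henv 0); lia).
  assert (Hy' : y ∈ dom r) by (apply (Henv 1); lia).
  assert (Hz' : z ∈ dom r) by (apply (Henv 2); lia).
  destruct (le_good Hr) as [(_ & [_ Hfun] & _) _].
  apply (Hfun x Hx' y Hy' z Hz'); [now apply Hy | now apply Hz].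
Qed.

Lemma forces_R_choice p rho : good p -> forces R_choice p rho.
Proof.
  intros Hp x q Hq Hne r Hr.
  destruct (extend_cond_in x (le_good Hr)) as (s & Hs & Hx).
  assert (Hx' : ~ empty x).
  { intros He. apply (Hne q (le_refl (le_good Hq))). intros u s' _. apply He. }
  destruct (le_good Hs) as [(_ & [Hch _] & _) _].
  destruct (Hch x Hx Hx') as (y & Hy & Hxy).
  exists s. split; [exact Hs|]. exists y. split; [exact Hy|].
  intros t (_ & Hd & E & _) _ _. cbn. apply E; auto.
  apply (proj1 (good_supertransitive (le_good Hs) Hx)), Hy.
Qed.

(** [Pi'] adds the single code [c], and the length of its tuple determines the formula. So if [Pi']
    fails while [Pi] is kept, this one promise has a counterexample in [d']. *)
Lemma unkept_promise d' f Pi Pi' c A j (sigma : nat -> M) :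
  nth_error Gs j = Some A -> code c (prefix (K + j) sigma) ->
  (forall u, u ∈ Pi' <-> u ∈ Pi \/ u = c) -> c ∈ d' ->
  fulfils d' f Pi -> ~ fulfils d' f Pi' ->
  exists y, y ∈ d' /\ isat f (scons y sigma) A.
Proof.
  intros HA Hc HPi' Hcd (H1 & H2 & H3 & H4) Hnot. apply NNPP. intros Hno. apply Hnot.
  split; [exact H1|]. split; [exact H2|]. split.
  { intros u Hu. apply HPi' in Hu as [Hu| ->]; auto. }
  intros c' Hc' y Hy. apply HPi' in Hc' as [Hc'| ->]; [auto|].
  intros j' A' l HA' Hl Hcl Hsat. apply Hno. exists y. split; [exact Hy|].
  rewrite <- (code_unique _ _ _ Hc Hcl) in *. rewrite prefix_length in Hl.
  assert (j' = j) as -> by lia. rewrite HA in HA'. injection HA' as <-.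
  revert Hsat. apply sat_agree. intros [|i] Hi; [reflexivity|]. cbn.
  assert (Hb := Gs_bound A (nth_error_In _ _ HA)). symmetry.
  apply pushes_prefix. lia.
Qed.

(** No condition below [q2] can promise that some [x] in [a] lacks a witness, so adding that promise
    fails at some height. A common height [D] for all [x] then contains the witnesses. *)
Lemma forces_collection A p rho : In A Gs -> good p -> forces (collection A) p rho.
Proof.
  intros HAG Hp a q Hq Hall q1 Hq1.
  assert (HA := Gs_Delta0P A HAG). assert (Hb := Gs_bound A HAG).
  destruct (In_nth_error _ _ HAG) as [j Hj]. set (n := K + j).
  (* [d0] receives the parameters and [d] the codes of all promises about members of [a], since
     promises have to be elements of the domain. *)
  destruct (supertransitive_extend_env (scons a rho) (S n) (good_supertransitive (le_good Hq1)))
    as (d0 & Hd0 & Hqd0 & Henv0).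
  destruct (code_exists n Hd0) as (d & Hd & Hd0d & Hcode).
  destruct (extend_cond (le_good Hq1) Hd (Sub_trans Hqd0 Hd0d)) as [f Hq2].
  set (q2 := Cond d f (prom q1)) in *.
  assert (Ha0 : a ∈ d0) by (apply (Henv0 0); lia).
  assert (Hx0 : forall x i, x ∈ a -> i < S n -> scons x (scons a rho) i ∈ d0).
  { intros x [|i] Hx Hi; [exact (proj1 (Hd0 a Ha0) x Hx) | apply Henv0; lia]. }
  assert (Hc : forall x, x ∈ a -> exists c, c ∈ d /\ code c (prefix n (scons x (scons a rho)))).
  { intros x Hx. apply Hcode; [apply prefix_length|].
    intros y Hy. apply prefix_in in Hy as (i & Hi & ->). apply Hx0; auto. }
  (* A condition with the promise for [x] would contradict that [Ex A] is forced at [x]. *)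
  assert (Hnone : forall x c r, x ∈ a -> code c (prefix n (scons x (scons a rho))) ->
    le r q2 -> ~ c ∈ prom r).
  { intros x c r Hx Hcx Hr Hcr.
    assert (Hrq : le r q) by exact (le_trans Hr (le_trans Hq2 Hq1)).
    destruct (Hall x r Hrq Hx r (le_refl (le_good Hr))) as (s & Hs & y & HyA).
    destruct (extend_cond_in y (le_good Hs)) as (t & Ht & Hyt).
    apply (forces_mono A _ Ht) in HyA.
    assert (Htr := le_trans Ht Hs). assert (Htq := le_trans Htr Hr).
    apply (forces_Delta0P HA) in HyA; [|exact (le_good Ht)|].
    - destruct (le_good Ht) as [(_ & _ & _ & Hprom) _].
      refine (Hprom c _ y Hyt j A _ Hj (prefix_length n _) Hcx _); [apply Htr, Hcr|].
      revert HyA. apply sat_agree. intros [|i] Hi; [reflexivity|]. cbn.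
      apply (pushes_prefix (n := n)). unfold n. lia.
    - intros [|i] Hi; [exact Hyt|]. apply Htq. cbn. apply Hd0d, Hx0; [exact Hx|]. unfold n. lia. }
  (* At height [d'], every approximation that agrees with [f] on [d] and keeps the old promises
     finds a witness for [x]. Indices 2 to 4 are [x], [d], [f]. *)
  destruct (@uniform_bound (fun s => eqv (s 3) (s 4) (s 0) -> exists y, y ∈ s 1 /\
      isat (s 0) (scons y (scons (s 2) (fun m => s (5 + m)))) A)
    (scons d (scons f (scons a rho))) a d (prom q1)) as (D & HD & HdD & Hbound).
  - apply D0_imp; [apply D0_eqv|]. apply D0_ex_in.
    eapply definable_iff; [|apply (@D0_isat A HA 1 (fun m => match m with 0 => 0 | 1 => 3 | S (S m) => 6 + m end))].
    intros s. cbv beta.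
    match goal with |- isat _ ?e1 _ <-> isat _ ?e2 _ => replace e1 with e2; [reflexivity|] end.
    apply functional_extensionality. now intros [|[|m]].
  - exact Hd.
  - cbn. intros x d' g g' Hx Hd' Hdd' E H Hg'.
    destruct H as (y & Hy & HyA); [exact (eqv_trans Hg' (eqv_sub Hdd' (eqv_sym E)))|].
    exists y. split; [exact Hy|]. apply (isat_eqv HA Hd' E) in HyA; [exact HyA|].
    intros [|i] Hi; [exact Hy|]. apply Hdd', Hd0d, Hx0; [exact Hx|]. unfold n. lia.
  - cbn. intros x Hx. destruct (Hc x Hx) as (c & Hcd & Hcx).
    destruct (m_pair c c) as [Pc HPc]. destruct (m_union2 (prom q1) Pc) as [Pi HPi].
    assert (HPi' : forall u, u ∈ Pi <-> u ∈ prom q1 \/ u = c).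
    { intros u. rewrite HPi. split; (intros [Hu|Hu]; [now left|right]); [|apply HPc; auto].
      apply HPc in Hu. tauto. }
    (* Otherwise [Cond d f Pi] would be a condition with the promise excluded by [Hnone]. *)
    assert (Hbad : exists d', supertransitive d' /\ Sub d d' /\
      forall g, eqv d f g -> ~ fulfils d' g Pi).
    { apply NNPP. intros Hno. apply (Hnone x c (Cond d f Pi) Hx Hcx); [|apply HPi'; auto].
      split; [|split; [apply Sub_refl | split; [apply eqv_refl | intros u Hu; apply HPi'; auto]]].
      assert (Hext : forall d', Sub d d' -> supertransitive d' -> exists g, eqv d f g /\ fulfils d' g Pi).
      { intros d' Hdd' Hd'. apply NNPP. intros Hn. apply Hno. exists d'. splits; auto.
        intros g Hg Hful. apply Hn. eauto. }
      split; [|exact Hext]. destruct (Hext d (Sub_refl (x := d)) Hd) as (g & Hg & Hful).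
      exact (fulfils_eqv Hful (eqv_sym Hg)). }
    destruct Hbad as (d' & Hd' & Hdd' & Hbad). exists d'. splits; auto.
    intros g Hg Hfg.
    destruct (unkept_promise _ _ Hj Hcx HPi' (Hdd' c Hcd) Hg (Hbad g Hfg)) as (y & Hy & HyA).
    now exists y.
  (* Any extension of [q2] to height [D] will do, and [D] itself is the collecting set. *)
  - cbn in Hbound. destruct (extend_cond (le_good Hq2) HD HdD) as [g Hr].
    set (r := Cond D g (prom q2)) in *.
    exists r. split; [exact (le_trans Hr Hq2)|]. exists D.
    intros x s Hs Hx t Ht. destruct (Hbound x Hx) as (d' & Hd' & Hdd' & Hd'D & Hex).
    destruct (Hex g) as (y & Hy & HyA).
    { destruct (le_good Hr) as [Hful _]. apply (fulfils_sub Hful Hd' Hd'D (Sub_refl (x := _))).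
      destruct (le_good Hq2) as [(_ & _ & Hpd & _) _]. exact (Sub_trans Hpd Hdd'). }
    { apply Hr. }
    exists t. split; [exact (le_refl (le_good Ht))|]. exists y. split; [exact (Hd'D y Hy)|].
    apply forces_ren.
    (* The renaming skips the collecting set, which has index 2. *)
    replace (fun m => scons y (scons x (scons D (scons a rho))) (up (up S) m)) with
      (scons y (scons x (scons a rho))) by (apply functional_extensionality; now intros [|[|m]]).
    assert (Henv : forall i, i < fv_bound A -> scons y (scons x (scons a rho)) i ∈ dom r).
    { intros [|i] Hi; [exact (Hd'D y Hy)|]. apply HdD, Hd0d, Hx0; [exact Hx|]. unfold n. lia. }
    assert (Htr := le_trans Ht Hs).
    apply (forces_Delta0P HA); [exact (le_good Ht) | intros i Hi; now apply Htr, Henv |].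
    apply (isat_le _ HA (le_good Hr) Henv Htr). exact HyA.
Qed.

(** [forces_collection] covers only formulae in [Gs], so instances of Collection are set apart. *)
Lemma forces_axiom X : KPP_GAC X ->
  (exists A, Delta0P A /\ X = closure (collection A)) \/ forall p rho, good p -> forces X p rho.
Proof.
  assert (Hfree : forall B, KPP_AC B -> forall p rho, good p -> forces (add_R B) p rho)
    by (intros B HB p rho Hp; apply forces_add_R; auto).
  intros [Y HY| |]; [destruct HY as [| | | | |A HA|A HA|A]| |].
  - right. exact (Hfree _ (AC_KPP KPP_ext)).
  - right. exact (Hfree _ (AC_KPP KPP_pair)).
  - right. exact (Hfree _ (AC_KPP KPP_union)).
  - right. exact (Hfree _ (AC_KPP KPP_inf)).
  - right. exact (Hfree _ (AC_KPP KPP_pow)).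
  - right. intros p rho Hp. apply forces_closure. intros s. now apply forces_separation.
  - left. now exists A.
  - right. intros p rho Hp. apply forces_closure. intros s. now apply forces_set_induction.
  - right. intros p rho Hp. now apply forces_R_functional.
  - right. intros p rho Hp. now apply forces_R_choice.
Qed.
End Forcing.
End SetModel.

(** * Forcing over a countermodel *)

Lemma collection_instances (L : list (form choice_symbol)) :
  exists Gs, (forall A, In A Gs -> Delta0P A) /\
    forall A, Delta0P A -> In (closure (collection A)) L ->
      exists B, In B Gs /\ closure (collection A) = closure (collection B).
Proof.
  induction L as [|X L (Gs & H1 & H2)].
  - exists []. split; [intros A [] | intros A _ []].
  - destruct (classic (exists B, Delta0P B /\ X = closure (collection B))) as [(B & HB & ->)|HX].
    + exists (B :: Gs). split.
      * intros A [<-|HA]; auto.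
      * intros A HA [E|HL]; [exists B; split; [now left | now symmetry]|].
        destruct (H2 A HA HL) as (C & HC & E). exists C. split; [now right | exact E].
    + exists Gs. split; [exact H1|]. intros A HA [->|HL]; [exfalso; eauto | auto].
Qed.

Theorem theorem3p2 (A : set_form) (hs : sentence A) (hA : SigmaP A)
  (h : provable KPP_GAC (add_R A)) : provable KPP_AC A.
Proof.
  apply NNPP. intros HA.
  destruct (countermodel enum_form KPP_AC_sentence enum_form_surj HA) as (M & mem & I & rho & Hmodel & HnA).
  apply HnA.
  destruct (derivable_compact h) as (L & HL & D).
  destruct (collection_instances L) as (Gs & HGs & Hcoll).
  (* Index 0 of each formula is the witness [y], so a bound of [S K] leaves at most [K] parameters
     for the tuple. *)
  set (K := list_max (map (@fv_bound choice_symbol) Gs)).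
  assert (HK : forall B, In B Gs -> fv_bound B <= S K).
  { intros B HB. assert (F := proj1 (list_max_le (map (@fv_bound choice_symbol) Gs) K) (le_n _)).
    rewrite Forall_forall in F. apply Nat.le_le_succ_r, F. now apply in_map. }
  (* The value [rho 0] serves to show that the model is inhabited. *)
  destruct (good_exists mem I Hmodel Gs K (rho 0)) as [p Hp].
  apply (forces_add_R I A rho Hp).
  apply (fun HT => forces_sound HT D rho Hp); [|intros X []].
  intros X HX q sigma Hq.
  destruct (forces_axiom mem I Hmodel Gs HGs HK (HL X HX)) as [(B & HB & ->)|HXf];
    [|now apply HXf].
  (* The instance is exchanged for the one whose body is listed in [Gs]. *)
  destruct (Hcoll B HB HX) as (C & HC & ->).
  apply forces_closure. intros s. now apply (forces_collection I Hmodel HGs HK).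
Qed.
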